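(* Let $k\ge1$ be an integer, $0<\beta\le1$, $\alpha,p>0$, and $n\in\{0,1,2,\ldots\}$. The probability mass function $\widetilde\eta_\beta(n|t,\alpha,p)=\mathbb{P}[\widetilde W^\Gamma_\beta(t)=n]$ of the space fractional Polya process satisfies the following equation in the time variable $t$: $$\frac{\partial^k}{\partial t^k}\widetilde\eta_\beta(n|t,\alpha,p)=\left(-\frac{(1-B_n)^\beta\,\Gamma(p+\beta)}{\alpha^{\beta}\,\Gamma(p)}\right)^k\widetilde\eta_\beta(n|t,\alpha,p+k\beta),$$ with $\widetilde\eta_\beta(n|0,\alpha,p)=1$ if $n=0$ and zero otherwise.
   Context: $\{D_\beta(t)\}_{t\ge0}$ is the $\beta$-stable subordinator, $\mathbb{E}[e^{-sD_\beta(t)}]=e^{-ts^\beta}$ ($D_1(t)=t$); $\{N(t,\lambda)\}_{t\ge0}$ is a Poisson process of rate $\lambda$, independent of $D_\beta$; $\Gamma$ is a random variable with the gamma density $g(y|\alpha,p)=\frac{\alpha^p}{\Gamma(p)}y^{p-1}e^{-\alpha y}$, $y>0$, independent of $\{D_\beta(t)\}$ and $\{N(t,\lambda)\}$. The space fractional Polya process (SFPP) is $\widetilde W^\Gamma_\beta(t)=N(D_\beta(t),\Gamma)$, so that $\widetilde\eta_\beta(n|t,\alpha,p)=\int_0^\infty\mathbb{P}[N(D_\beta(t),y)=n]\,g(y|\alpha,p)\,dy$; it is $0$ for $n<0$. $B_n$ is the backward shift operator, $B_nu(n,t)=u(n-1,t)$, and $(1-B_n)^\beta=\sum_{r=0}^\infty\frac{\Gamma(\beta+1)}{\Gamma(r+1)\Gamma(\beta-r+1)}(-1)^rB_n^r$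 (with $1/\Gamma=0$ at nonpositive integers); $k$-th powers of operators denote composition.
   Formalization: The k-th power is read as a composition in which p is replaced by p, p+β, …, p+(k−1)β in the successive factors; with the same p in every factor the equation fails for k≥2 (e.g. β=1, n=0, k=2: p(p+1)/α² is needed, not p²/α²). *)

(* Defs.v *)
From HB Require Import structures.
From mathcomp Require Import all_boot all_order all_algebra.
From mathcomp Require Import all_classical all_reals all_analysis.

Set Implicit Arguments.
Unset Strict Implicit.
Unset Printing Implicit Defensive.

Import Order.TTheory GRing.Theory Num.Theory.
Import numFieldNormedType.Exports.

Local Open Scope classical_set_scope.
Local Open Scope ring_scope.

(** * Gamma function and gamma distribution *)

(* Meaningful for [0 < x] only. *)
Definition Gamma (R : realType) (x : R) : R :=
  \int[lebesgue_measure]_(y in `]0%R, +oo[) (y `^ (x - 1) * expR (- y)).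

(* The entire function 1/Gamma on the real line: for [x <= 0] it is obtained
   from 1/Gamma(x) = x (x+1) ... (x+m-1) / Gamma(x+m) with x+m > 0; in
   particular it vanishes at the nonpositive integers. *)
Definition rGamma (R : realType) (x : R) : R :=
  let m := if 0 < x then 0%N else `|Num.floor x|%N.+1 in
  (\prod_(i < m) (x + i%:R)) / Gamma (x + m%:R).

Definition gamma_pdf (R : realType) (alpha p y : R) : R :=
  if 0 < y then alpha `^ p / Gamma p * y `^ (p - 1) * expR (- alpha * y)
  else 0.

Definition gamma_distributed d (T : measurableType d) (R : realType)
    (P : probability T R) (G : T -> R) (alpha p : R) : Prop :=
  measurable_fun setT G /\
  forall B : set R, measurable B ->
    P (G @^-1` B) = (\int[lebesgue_measure]_(y in B) (gamma_pdf alpha p y)%:E)%E.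

(** * Processes, indexed by times [t >= 0]; negative times are ignored *)

(* The sigma-algebra on [T] generated by the family [(X i)_(i in J)]. *)
Definition sigma_family d (T : Type) (U : measurableType d) (I : Type)
    (J : set I) (X : I -> T -> U) : set (set T) :=
  <<s \bigcup_(i in J) preimage_set_system setT (X i) measurable >>.

(* Nondecreasing real Levy process started at 0. *)
Definition subordinator d (T : measurableType d) (R : realType)
    (P : probability T R) (X : R -> T -> R) : Prop :=
  [/\ forall t, 0 <= t -> measurable_fun setT (X t),
      {ae P, forall w, X 0 w = 0},
      (forall s t, 0 <= s -> s <= t ->
         forall (A : set T) (B : set R),
           sigma_family [set u | 0 <= u <= s] X A -> measurable B ->
           P (A `&` (X t \- X s) @^-1` B) =
           (P A * P ((X t \- X s)%R @^-1` B))%E),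
      (forall s t, 0 <= s -> s <= t -> forall B : set R, measurable B ->
         P ((X t \- X s) @^-1` B) = P (X (t - s) @^-1` B)) &
      {ae P, forall w,
         (forall s t, 0 <= s -> s <= t -> X s w <= X t w) /\
         (forall t, 0 <= t -> X u w @[u --> t^'+] --> X t w)}].

Definition stable_subordinator d (T : measurableType d) (R : realType)
    (P : probability T R) (beta : R) (D : R -> T -> R) : Prop :=
  subordinator P D /\
  forall s t, 0 <= s -> 0 <= t ->
    'E_P[fun w => expR (- (s * D t w))]%E = (expR (- (t * s `^ beta)))%:E.

Definition poisson_process d (T : measurableType d) (R : realType)
    (P : probability T R) (lambda : R) (N : R -> T -> nat) : Prop :=
  subordinator P (fun t w => (N t w)%:R) /\
  forall t m, 0 < t ->
    P (N t @^-1` [set m]) = (poisson_pmf (lambda * t) m)%:E.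

(* Pairs (t, lambda) of a time and a rate. *)
Definition time_rate (R : realType) : set (R * R) :=
  [set x | 0 <= x.1 /\ 0 < x.2].

Definition sigma_field_of d (T : measurableType d) (R : realType)
    (N : R -> R -> T -> nat) : set (set T) :=
  sigma_family (@time_rate R) (fun x => N x.1 x.2).

(* The family N(t, lambda) of Poisson processes. The last condition (it
   holds for N(t, lambda) = N(lambda t, 1) with right-continuous paths) gives a
   meaning to the random substitution N(D, G): without measurability with
   respect to the sigma-algebra of the family itself, independence of (D, G)
   from the family would not determine the law of N(D, G). *)
Definition poisson_family d (T : measurableType d) (R : realType)
    (P : probability T R) (N : R -> R -> T -> nat) : Prop :=
  (forall lambda, 0 < lambda -> poisson_process P lambda (fun t => N t lambda))
  /\ measurable_fun
       [set x : g_sigma_algebraType (sigma_field_of N) * (R * R)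
          | time_rate x.2]
       (fun x => N x.2.1 x.2.2 x.1).

(* For families containing [setT], this is mutual independence. *)
Definition independent3 d (T : measurableType d) (R : realType)
    (P : probability T R) (F1 F2 F3 : set (set T)) : Prop :=
  forall A B C, F1 A -> F2 B -> F3 C ->
    P (A `&` B `&` C) = (P A * P B * P C)%E.

(* [W] is a space fractional Polya process W(t) = N(D(t), G). *)
Definition is_sfpp d (T : measurableType d) (R : realType)
    (P : probability T R) (beta alpha p : R) (W : R -> {RV P >-> nat}) : Prop :=
  exists (D : R -> T -> R) (N : R -> R -> T -> nat) (G : T -> R),
    [/\ stable_subordinator P beta D,
        poisson_family P N,
        gamma_distributed P G alpha p,
        independent3 P (sigma_field_of N)
          (sigma_family [set t | 0 <= t] D)
          (preimage_set_system setT G measurable) &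
        forall t, 0 <= t -> {ae P, forall w, W t w = N (D t w) (G w) w}].

(* P[W = n] for an integer [n]; it is 0 for [n < 0]. *)
Definition pmfz d (T : measurableType d) (R : realType)
    (P : probability T R) (W : {RV P >-> nat}) (n : int) : R :=
  fine (P [set w | (W w)%:Z = n]).

(** * Operators on sequences indexed by the integers *)

Definition backshift (R : realType) (u : int -> R) : int -> R :=
  fun n => u (n - 1).

(* (1 - B)^beta *)
Definition frac_diff (R : realType) (beta : R) (u : int -> R) : int -> R :=
  fun n => limn (series (fun r : nat =>
    Gamma (beta + 1) / Gamma (r.+1%:R) * rGamma (beta - r%:R + 1)
    * (-1) ^+ r * iter r (@backshift R) u n)).

(* The operator - (1 - B)^beta Gamma(p + beta) / (alpha^beta Gamma(p)); it
   carries the probability mass function with parameter [p + beta] to the time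
   derivative of the one with parameter [p]. *)
Definition sfpp_op (R : realType) (beta alpha p : R) (u : int -> R) :
    int -> R :=
  fun n => - (frac_diff beta u n * Gamma (p + beta)
              / (alpha `^ beta * Gamma p)).

(* Its [k]-th power, as a composition
     sfpp_op p \o sfpp_op (p + beta) \o ... \o sfpp_op (p + (k - 1) beta)
   along the parameters p <- p + beta <- ... <- p + k beta. Keeping the same
   [p] in all the factors would give the wrong constant for [k >= 2]: with
   beta = 1 and n = 0 the mass function is (alpha / (alpha + t))^p, whose second
   derivative has the factor p (p + 1) / alpha^2 and not (p / alpha)^2. *)
Fixpoint sfpp_op_pow (R : realType) (beta alpha p : R) (k : nat)
    (u : int -> R) : int -> R :=
  if k is k'.+1
  then sfpp_op beta alpha p (sfpp_op_pow beta alpha (p + beta) k' u)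
  else u.

(** * Derivatives on the half-line [t >= 0] (one-sided at 0) *)

Definition is_derive_ge0 (R : realType) (f f' : R -> R) : Prop :=
  forall t, 0 <= t ->
    h^-1 * (f (t + h) - f t) @[h --> within [set h | 0 <= t + h] 0^']
      --> f' t.

Fixpoint is_nderive_ge0 (R : realType) (k : nat) (f g : R -> R) : Prop :=
  if k is k'.+1
  then exists2 f', is_derive_ge0 f f' & is_nderive_ge0 k' f' g
  else forall t, 0 <= t -> f t = g t.

(* Main.v *)
Require Import Defs.
From HB Require Import structures.
From mathcomp Require Import all_boot all_order all_algebra.
From mathcomp Require Import all_classical all_reals all_analysis.
From mathcomp Require Import measurable_realfun.
From mathcomp Require Import ring lra zify.

Import Order.TTheory GRing.Theory Num.Theory.
Import numFieldNormedType.Exports.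

Local Open Scope classical_set_scope.
Local Open Scope ring_scope.

(** Why the theorem holds. Conditionally on the rate [y], the process is a
    Poisson process run at the stable time [D t], so the generating function of
    its law is the Laplace transform of [D t] at [y (1 - z)], that is
    [exp (- w (1 - z)^beta)] with [w = t y^beta]. Write [A_n(w)] for its
    coefficient of [z^n]. Differentiating the generating function in [w] gives
<<
      A_n' = - sum_(r <= n) c_r A_(n-r),      (1 - z)^beta = sum_r c_r z^r,
>>
    so the time derivative of the conditional mass function is [- y^beta]
    times its fractional difference. The remaining factor [y^beta] turns the
    gamma density with parameter [p] into the one with parameter [p + beta],
    times Gamma (p + beta) / (alpha^beta Gamma p). Integrating over [y] gives
    the case [k = 1], with [p + beta] on the right-hand side, and the general
    case follows by induction on [k].

    No power series is manipulated. The function [A_n] is [e^(-w)] times a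
    polynomial ([stable_poly]) defined by a recursion, for which the displayed
    equation is a polynomial identity ([twist_stable_poly]). That [A_n] is the
    conditional mass is obtained by differentiating the Laplace transform of
    [D t] repeatedly ([stable_moment]); the random substitution in [N] is then
    resolved by independence and Tonelli's theorem ([independent3_law],
    [sfpp_law]). Sums over [r] are finite because the mass vanishes at
    negative integers ([frac_diff_nat]), and their coefficients agree with the
    quotients of Gamma values through the functional equation of Gamma
    ([frac_coefE]). Finally, [A_n] and its derivatives are bounded on the
    half-line, which yields a quadratic remainder with an integrable bound, and
    so differentiation under the integral for all [t >= 0], the end point
    included ([polya_pmf_derive]). *)

Set Implicit Arguments.
Unset Strict Implicit.
Unset Printing Implicit Defensive.

(** * The polynomials behind the Poisson mixture over a stable law *)

(** The coefficient [(-1)^r (beta choose r)] of [z^r] in [(1 - z)^beta], by the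
    recursion that it satisfies. *)
Fixpoint diff_coef (R : realType) (beta : R) (r : nat) : R :=
  if r is q.+1 then (q%:R - beta) / q.+1%:R * diff_coef beta q else 1.

(** The polynomial part of the derivative of [e^(-w) q(w)], which is
    [e^(-w) (q' - q)(w)]. *)
Definition twist (R : realType) (q : {poly R}) : {poly R} := q^`() - q.

(** The product [e^(-w) Q_n(w)], with [Q_n] the polynomial defined here, is the
    coefficient of [z^n] in [A = exp (- w (1 - z)^beta)]. The recursion is the
    partial differential equation
    [(1 - z) dA/dz = - beta w dA/dw] read off on coefficients of [z^n]. *)
Fixpoint stable_poly (R : realType) (beta : R) (n : nat) : {poly R} :=
  if n is m.+1 then
    m.+1%:R^-1 *: (m%:R *: stable_poly beta m - beta *: ('X * twist (stable_poly beta m)))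
  else 1.

Lemma twistX (R : realType) (q : {poly R}) : twist ('X * q) = q + 'X * twist q.
Proof. by rewrite /twist derivM derivX mul1r mulrBr addrA. Qed.

Lemma twistZ (R : realType) (a : R) (q : {poly R}) : twist (a *: q) = a *: twist q.
Proof. by rewrite /twist derivZ scalerBr. Qed.

Lemma twistB (R : realType) (q r : {poly R}) : twist (q - r) = twist q - twist r.
Proof. by rewrite /twist derivB; ring. Qed.

Lemma twist_sum (R : realType) (n : nat) (F : nat -> {poly R}) :
  twist (\sum_(i < n) F i) = \sum_(i < n) twist (F i).
Proof. by rewrite /twist raddf_sum -sumrB. Qed.

Lemma stable_polyS (R : realType) (beta : R) (m : nat) :
  m.+1%:R *: stable_poly beta m.+1
  = m%:R *: stable_poly beta m - beta *: ('X * twist (stable_poly beta m)).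
Proof. by rewrite scalerA mulfV ?pnatr_eq0// scale1r. Qed.

Lemma diff_coefS (R : realType) (beta : R) (r : nat) :
  r.+1%:R * diff_coef beta r.+1 = (r%:R - beta) * diff_coef beta r.
Proof. by rewrite /= mulrA mulrCA mulfV ?pnatr_eq0// mulr1. Qed.

Arguments diff_coef : simpl never.

(** Coefficientwise form of [dA/dw = - (1 - z)^beta A] for the generating
    function [A = exp (- w (1 - z)^beta)]. It is not the equation that defines
    the polynomials; the proof derives it by strong induction: differentiating
    the recursion brings in the second derivative of the [n]-th coefficient,
    which the induction hypothesis turns into first derivatives, and these the
    recursion turns back into coefficients. *)
Lemma twist_stable_poly (R : realType) (beta : R) (n : nat) :
  twist (stable_poly beta n) = - \sum_(r < n.+1) diff_coef beta r *: stable_poly beta (n - r)%N.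
Proof.
elim/ltn_ind: n => -[_|n IH].
  by rewrite big_ord1 /= /diff_coef scale1r /twist derivC sub0r.
have n0 : n.+1%:R != 0 :> R by rewrite pnatr_eq0.
apply: (scalerI n0); rewrite -twistZ stable_polyS.
rewrite twistB !twistZ twistX.
transitivity ((n%:R - beta) *: twist (stable_poly beta n)
    - beta *: ('X * twist (twist (stable_poly beta n)))).
  by move: (twist (twist _)) => b; move: (twist _) => a; rewrite scalerDr scalerBl opprD addrA.
have -> : twist (twist (stable_poly beta n)) =
   - \sum_(r < n.+1) diff_coef beta r *: twist (stable_poly beta (n - r)%N).
  rewrite {1}IH// -scaleN1r twistZ scaleN1r (twist_sum _ (fun r => diff_coef beta r *: stable_poly beta (n - r)%N)).
  by congr (- _); apply: eq_bigr => r _; rewrite twistZ.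
rewrite IH// !scalerN mulrN scalerN opprK.
rewrite mulr_sumr !scaler_sumr -sumrN -big_split/=.
(* The recursion [(r+1) c_(r+1) = (r - beta) c_r] splits the sum into one
   weighted by [r] and one weighted by [n + 1 - r]; the weights add up to [n + 1]. *)
transitivity (- \sum_(r < n.+1) (r.+1%:R * diff_coef beta r.+1) *: stable_poly beta (n.+1 - r.+1)%N
   - \sum_(r < n.+1) ((n.+1 - r)%:R * diff_coef beta r) *: stable_poly beta (n.+1 - r)%N).
  rewrite -!sumrN -big_split/=; apply: eq_bigr => r _.
  have rn : (r <= n)%N by rewrite -ltnS.
  rewrite subSS diff_coefS subSn//.
  have -> : beta *: ('X * (diff_coef beta r *: twist (stable_poly beta (n - r)))) =
      diff_coef beta r *: ((n - r)%:R *: stable_poly beta (n - r)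
                      - (n - r).+1%:R *: stable_poly beta (n - r).+1).
    by rewrite stable_polyS opprB addrC subrK -scalerAr !scalerA mulrC.
  rewrite scalerBr !scalerA addrA (mulrC (diff_coef beta r) _.+1%:R); congr (_ - _).
  rewrite -!scaleNr -scalerDl natrB//; congr (_ *: _).
  by rewrite /GRing.scale /=; ring.
transitivity (- \sum_(r < n.+2) n.+1%:R *: (diff_coef beta r *: stable_poly beta (n.+1 - r)%N)); last first.
  by rewrite -scaler_sumr.
rewrite -opprD; congr (- _).
pose g (r : nat) := diff_coef beta r *: stable_poly beta (n.+1 - r)%N.
transitivity (\sum_(r < n.+2) r%:R *: g r + \sum_(r < n.+2) (n.+1 - r)%:R *: g r).
  rewrite [in RHS]big_ord_recl scale0r add0r; congr (_ + _).
    by apply: eq_bigr => r _; rewrite /g scalerA.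
  rewrite [RHS]big_ord_recr/= subnn scale0r addr0.
  by apply: eq_bigr => r _; rewrite /g scalerA.
rewrite -big_split/=; apply: eq_bigr => r _.
by rewrite -scalerDl -natrD subnKC// -ltnS.
Qed.

(** * Polynomials times a decaying exponential, and difference quotients *)

(** Both orders of [x] and [x'] are needed: increments of time may be
    negative. *)
Lemma mvt_between (R : realType) (f f1 : R -> R) (lo x x' : R) :
  (forall u : R, is_derive u 1 f (f1 u)) -> lo <= x -> lo <= x' ->
  exists c, [/\ lo <= c, `|c - x| <= `|x' - x| & f x' - f x = f1 c * (x' - x)].
Proof.
move=> df; have cf : continuous f.
  by move=> u; apply/differentiable_continuous/derivable1_diffP; have [] := df u.
have [xx'|x'x] := leP x x' => lox lox'.
  have [c + ->] := @MVT_segment R f f1 x x' xx' (fun u _ => df u)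
    (continuous_subspaceT cf).
  rewrite in_itv/= => /andP[xc cx']; exists c; split => //.
    exact: le_trans xc.
  by rewrite !ger0_norm ?subr_ge0// lerB.
have [c + e] := @MVT_segment R f f1 x' x (ltW x'x) (fun u _ => df u)
  (continuous_subspaceT cf).
rewrite in_itv/= => /andP[xc cx']; exists c; split => //.
- exact: le_trans xc.
- by rewrite !ler0_norm ?subr_le0// ?(ltW x'x)// lerN2 lerB.
- by rewrite -opprB e -mulrN opprB.
Qed.

(** A quadratic error in the increment is the form of differentiability that
    passes through an integral by mere monotonicity, and that also covers the
    one-sided derivative at the left end [lo]. *)
Lemma taylor2_le (R : realType) (f f1 f2 : R -> R) (lo C : R) :
  (forall u : R, is_derive u 1 f (f1 u)) -> (forall u : R, is_derive u 1 f1 (f2 u)) ->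
  (forall u, lo <= u -> `|f2 u| <= C) ->
  forall x x', lo <= x -> lo <= x' ->
  `|f x' - f x - (x' - x) * f1 x| <= C * (x' - x) ^+ 2.
Proof.
move=> df df1 f2C x x' lox lox'.
have [c [loc cx ->]] := mvt_between df lox lox'.
have [c' [loc' c'x e]] := mvt_between df1 lox loc.
rewrite (mulrC (x' - x)) -mulrBl e -mulrA normrM.
apply: ler_pM => //; first exact: f2C.
by rewrite normrM -real_normK ?num_real// expr2 ler_wpM2r.
Qed.

Definition pexp (R : realType) (q : {poly R}) (w : R) : R := expR (- w) * q.[w].

Lemma is_derive_pexp (R : realType) (q : {poly R}) (w : R) :
  is_derive w 1 (pexp q) (pexp (twist q) w).
Proof.
have dq : is_derive w 1 (horner q) (q^`().[w]).
  by rewrite derivE derive1E; apply/derivableP/derivable_horner.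
rewrite /pexp; apply: is_derive_eq.
by rewrite /twist hornerD hornerN /GRing.scale/=; ring.
Qed.

Lemma continuous_pexp (R : realType) (q : {poly R}) : continuous (pexp q).
Proof.
move=> w; apply/differentiable_continuous/derivable1_diffP.
by have [] := is_derive_pexp q w.
Qed.

Lemma exprn_le_expR (R : realType) (x : R) (n : nat) :
  0 <= x -> x ^+ n <= n`!%:R * expR x.
Proof.
move=> x0; case: n => [|n].
  by rewrite fact0 mul1r expr0 -expR0 ler_expR.
rewrite mulrC -ler_pdivrMr ?ltr0n ?fact_gt0//.
by apply: le_trans (expR_ge1Dxn n x0); rewrite lerDr.
Qed.

Lemma pexp_bounded (R : realType) (q : {poly R}) :
  exists2 M, 0 <= M & forall w, 0 <= w -> `|pexp q w| <= M.
Proof.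
exists (\sum_(i < size q) `|q`_i| * i`!%:R).
  by apply: sumr_ge0 => i _; rewrite mulr_ge0.
move=> w w0; rewrite /pexp horner_coef mulr_sumr.
apply: le_trans (ler_norm_sum _ _ _) _; apply: ler_sum => i _.
rewrite mulrCA normrM ler_wpM2l// ger0_norm; last first.
  by rewrite mulr_ge0 ?expR_ge0 ?exprn_ge0.
by rewrite expRN mulrC ler_pdivrMr ?expR_gt0// exprn_le_expR.
Qed.

(** The constant is uniform on the whole half-line, since polynomials times
    [e^(-w)] are bounded there. *)
Lemma pexp_taylor (R : realType) (q : {poly R}) :
  exists2 C, 0 <= C & forall w w', 0 <= w -> 0 <= w' ->
  `|pexp q w' - pexp q w - (w' - w) * pexp (twist q) w| <= C * (w' - w) ^+ 2.
Proof.
have [C C0 hC] := pexp_bounded (twist (twist q)); exists C => //.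
by apply: taylor2_le hC => u; exact: is_derive_pexp.
Qed.

(** The set [E] of admissible increments makes this usable both at interior
    points and at the boundary point of a half-line. *)
Lemma cvg_diff_quotient (R : realType) (E : set R) (F : R -> R) (t F' C rho : R) :
  0 < rho ->
  (forall h, E h -> `|h| < rho -> `|F (t + h) - F t - h * F'| <= C * h ^+ 2) ->
  h^-1 * (F (t + h) - F t) @[h --> within E 0^'] --> F'.
Proof.
move=> rho0 hF; apply/cvgrPdist_le => e e0.
have C1 : 0 < `|C| + 1 by rewrite ltr_wpDl.
rewrite near_withinE /=; near=> h => Eh.
have h0 : h != 0 by near: h; exact: nbhs_dnbhs_neq.
have hh : `|h| < rho.
  by near: h; apply: dnbhs0_lt.
have he : `|h| <= e / (`|C| + 1).
  by near: h; apply: dnbhs0_le; rewrite divr_gt0.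
rewrite distrC -[F' in leLHS](mulKf h0) -mulrBr normrM normfV.
rewrite ler_pdivrMl ?normr_gt0//.
apply: le_trans (hF _ Eh hh) _.
rewrite -real_normK ?num_real// expr2 mulrA (mulrC _ `|h|) ler_wpM2l//.
apply: le_trans (_ : (`|C| + 1) * `|h| <= _).
  by rewrite ler_wpM2r// (le_trans (ler_norm _))// lerDl.
by rewrite mulrC -ler_pdivlMr.
Unshelve. all: by end_near. Qed.

(** * Moments of a law with a stable Laplace transform *)

(** Differentiation under the integral sign, in the form of a first-order
    expansion with an integrable error. *)
Lemma Rintegral_taylor d (T : measurableType d) (R : realType)
    (mu : {measure set T -> \bar R}) (D : set T) (f0 f1 df g : T -> R) (h C : R) :
  measurable D ->
  mu.-integrable D (EFin \o f0) -> mu.-integrable D (EFin \o f1) ->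
  mu.-integrable D (EFin \o df) -> mu.-integrable D (EFin \o g) ->
  (forall x, D x -> `|f1 x - f0 x - h * df x| <= C * g x) ->
  `|\int[mu]_(x in D) f1 x - \int[mu]_(x in D) f0 x - h * \int[mu]_(x in D) df x|
    <= C * \int[mu]_(x in D) g x.
Proof.
move=> mD if0 if1 idf ig fg.
have ihd : mu.-integrable D (EFin \o (fun x => h * df x)).
  by apply: (eq_integrable _ (fun x => (h%:E * (EFin \o df) x)%E)) => //;
    exact: integrableZl.
have i10 : mu.-integrable D (EFin \o (fun x => f1 x - f0 x)).
  by apply: (eq_integrable _ (fun x => ((EFin \o f1) x - (EFin \o f0) x)%E)) => //;
    exact: integrableB.
have iall : mu.-integrable D (EFin \o (fun x => f1 x - f0 x - h * df x)).
  by apply: (eq_integrable _ (fun x => ((EFin \o (fun x => f1 x - f0 x)%R) x -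
     (EFin \o (fun x => h * df x)%R) x)%E)) => //; exact: integrableB.
have iCg : mu.-integrable D (EFin \o (fun x => C * g x)).
  by apply: (eq_integrable _ (fun x => (C%:E * (EFin \o g) x)%E)) => //;
    exact: integrableZl.
rewrite -(RintegralZl _ mD idf) -(RintegralB mD if1 if0) -(RintegralB mD i10 ihd).
rewrite -(RintegralZl _ mD ig).
apply: le_trans (le_normr_Rintegral mD iall) _.
apply: le_Rintegral => //.
by apply: (eq_integrable _ (abse \o (EFin \o (fun x => f1 x - f0 x - h * df x)))) => //;
  exact: integrable_abse.
Qed.

Section laplace.
Variables (R : realType) (mu : probability R R).
Local Notation D := (`[0%R, +oo[%classic : set R).

Definition moment (n : nat) (s : R) : R :=
  \int[mu]_(x in D) (x ^+ n * expR (- (s * x))).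

(** Since [(s x)^n <= n! e^(s x)], the integrand is bounded. *)
Lemma moment_integrable (n : nat) (s : R) : 0 < s ->
  mu.-integrable D (EFin \o (fun x => x ^+ n * expR (- (s * x)))).
Proof.
move=> s0; apply: measurable_bounded_integrable => //.
- by rewrite (le_lt_trans (probability_le1 _ _)) ?ltry.
- apply: measurable_funTS; apply: measurable_funM; first exact: exprn_measurable.
  by apply: measurableT_comp => //; apply: measurableT_comp => //;
    exact: mulrl_measurable.
- exists (n`!%:R / s ^+ n); split; first exact: num_real.
  move=> M hM x /=; rewrite in_itv/= andbT => x0.
  apply: le_trans (ltW hM).
  rewrite ger0_norm ?mulr_ge0 ?exprn_ge0 ?expR_ge0//.
  rewrite ler_pdivlMr ?exprn_gt0// mulrAC -exprMn expRN ler_pdivrMr ?expR_gt0//.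
  by rewrite (mulrC s x) exprn_le_expR// mulr_ge0// ltW.
Qed.

(** For increments smaller than [s / 2] the second derivative in [s] of
    [x^n e^(-s x)] stays below [x^(n+2) e^(-(s/2) x)]. *)
Lemma moment_diff_quotient (n : nat) (s : R) : 0 < s ->
  h^-1 * (moment n (s + h) - moment n s) @[h --> 0^'] --> - moment n.+1 s.
Proof.
move=> s0; have s20 : 0 < s / 2 by rewrite divr_gt0.
have := @cvg_diff_quotient R setT (moment n) s (- moment n.+1 s)
  (moment n.+2 (s / 2)) (s / 2) s20.
rewrite withinET; apply=> h _ hs.
have lo : s / 2 <= s + h.
  by move: hs; rewrite ltr_norml => /andP[h1 _]; lra.
have sh0 : 0 < s + h by exact: lt_le_trans lo.
rewrite mulrN -mulNr (mulrC (moment _ _)).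
apply: (Rintegral_taylor (measurable_itv _) (moment_integrable n s0)
  (moment_integrable n sh0) (moment_integrable n.+1 s0)
  (moment_integrable n.+2 s20)) => x /=.
rewrite in_itv/= andbT => x0.
have d (m : nat) (u : R) : is_derive u 1 (fun u : R => x ^+ m * expR (- (u * x)))
    (- (x ^+ m.+1 * expR (- (u * x)))).
  have -> : (fun u : R => x ^+ m * expR (- (u * x))) =
     (x ^+ m) \*: (expR \o (fun u : R => - x * u)).
    by apply/funext => v; rewrite /GRing.scale/=; congr (_ * expR _); ring.
  have dl : is_derive u 1 (fun u : R => - x * u) (- x).
    have -> : (fun u : R => - x * u) = (- x) \*: (@id R) by [].
    by apply: is_derive_eq; rewrite /GRing.scale /= mulr1.
  apply: is_derive_eq; rewrite /GRing.scale/= (_ : - x * u = - (u * x)); last by ring.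
  by rewrite exprS; ring.
have dN (u : R) : is_derive u 1 (fun u : R => - (x ^+ n.+1 * expR (- (u * x))))
    (x ^+ n.+2 * expR (- (u * x))).
  have dn := d n.+1 u.
  have -> : (fun u : R => - (x ^+ n.+1 * expR (- (u * x)))) =
    - (fun u : R => (x ^+ n.+1 * expR (- (u * x)))) by [].
  by apply: is_derive_eq; rewrite opprK.
have := @taylor2_le R _ _ _ (s / 2) (x ^+ n.+2 * expR (- (s / 2 * x)))
  (d n) dN _ s (s + h) _ lo.
rewrite (addrC s h) addrK mulrN mulNr opprK => H.
rewrite [leRHS]mulrC; apply: H.
- have xn : 0 <= x ^+ n.+2 by exact: exprn_ge0.
  move=> u su; rewrite ger0_norm; last by rewrite mulr_ge0// expR_ge0.
  by apply: ler_wpM2l => //; rewrite ler_expR lerN2 ler_wpM2r.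
- by lra.
Qed.

Lemma pexp_stable_polyS (beta : R) (n : nat) (w : R) :
  n.+1%:R * pexp (stable_poly beta n.+1) w =
  n%:R * pexp (stable_poly beta n) w - beta * w * pexp (twist (stable_poly beta n)) w.
Proof.
move: (stable_polyS beta n); move: (stable_poly beta n.+1) (stable_poly beta n) => q1 q0.
move/(congr1 (fun q => expR (- w) * q.[w])); move: (twist q0) => q0'.
rewrite hornerZ hornerD hornerN !hornerZ hornerM hornerX /pexp => H.
by rewrite mulrCA H; ring.
Qed.

(** The recursion of the polynomials is exactly what makes the closed form of
    the [n]-th moment differentiate to minus that of the [(n+1)]-st. *)
Lemma moment_closed_derive (beta t s : R) (n : nat) : 0 < beta -> 0 < s ->
  is_derive s 1 (fun s : R => n`!%:R * (s ^+ n)^-1 * pexp (stable_poly beta n) (t * s `^ beta))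
    (- (n.+1`!%:R * (s ^+ n.+1)^-1 * pexp (stable_poly beta n.+1) (t * s `^ beta))).
Proof.
move=> b0 s0.
have s0' : s ^+ n != 0 by rewrite expf_neq0// gt_eqF.
have dX : is_derive s 1 (fun s : R => s ^+ n) (n%:R * s ^+ n.-1).
  have := @is_deriveX R R (@id R) n s 1 1 (is_derive_id _ _).
  rewrite /GRing.scale/= mulr1.
  suff -> : @id R ^+ n = (fun s => s ^+ n) by [].
  by apply/funext => u; elim: n {s0'} => // m IH; rewrite !exprS -IH.
have dV := @is_deriveV R (fun s : R => s ^+ n) s _ 1 s0' dX.
have dw : is_derive s 1 (fun s : R => t * s `^ beta) (t * (beta * s `^ (beta - 1))).
  have dp := is_derive1_powR beta s0.
  exact: (@is_deriveZ R R R (fun s => s `^ beta) t s 1 _ dp).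
have dp := @is_derive1_comp R (pexp (stable_poly beta n)) (fun s : R => t * s `^ beta) s _ _
  (is_derive_pexp (stable_poly beta n) _) dw.
have dVp := is_deriveM dV dp.
have := is_deriveZ n`!%:R dVp.
have -> : n`!%:R \*: ((fun s : R => (s ^+ n)^-1) * (pexp (stable_poly beta n) \o (fun s : R => t * s `^ beta)))
  = (fun s : R => n`!%:R * (s ^+ n)^-1 * pexp (stable_poly beta n) (t * s `^ beta)).
  by apply/funext => u; rewrite -mulrA.
move=> H; apply: (is_derive_eq H).
have := pexp_stable_polyS beta n (t * s `^ beta).
rewrite -(mulr_powRB1 (ltW s0) b0) factS natrM /GRing.scale/=.
rewrite -(mulr_powRB1 (ltW s0) b0).
move: (pexp (stable_poly beta n.+1) _) => p1.
move: (pexp (stable_poly beta n) _) => p0.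
move: (pexp _ _) => q0.
move: (s `^ _) => b e.
transitivity (- (n`!%:R / s ^+ n.+1 * (n.+1%:R * p1))); last first.
  by rewrite mulrCA !mulrA.
rewrite e; have sN0 : s != 0 by rewrite gt_eqF.
case: (n) s0' => [|m] sm.
  by rewrite expr0 expr1 mul0r; field.
rewrite /= exprS; move: sm; rewrite exprS mulf_eq0 negb_or => /andP[_ sm].
rewrite (exprS s m.+1) (exprS s m).
by move: (s ^+ m) sm => z z0; field; rewrite z0 sN0.
Qed.

(** Moments follow from the Laplace transform by repeated differentiation in
    [s > 0]; by uniqueness of derivatives the closed form propagates from [n] to
    [n + 1]. *)
Lemma stable_moment (beta t : R) (n : nat) (s : R) : 0 < beta ->
  (forall s : R, 0 < s -> moment 0 s = expR (- (t * s `^ beta))) -> 0 < s ->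
  moment n s = n`!%:R * (s ^+ n)^-1 * pexp (stable_poly beta n) (t * s `^ beta).
Proof.
move=> b0 m0; elim: n s => [|n IH] s s0.
  by rewrite m0// fact0 expr0 invr1 !mul1r /pexp hornerC mulr1.
have [_ dv] := moment_closed_derive t n b0 s0.
set G := (fun s : R => _) in dv.
apply: oppr_inj; rewrite -[RHS]dv.
apply/esym/cvg_lim => //.
have H := @moment_diff_quotient n s s0.
refine (cvg_trans _ H); apply: near_eq_cvg.
near=> h; have sh : 0 < s + h.
  have : `|h| < s by near: h; apply: dnbhs0_lt.
  by rewrite ltr_norml => /andP[+ _]; lra.
by rewrite (IH _ s0) (IH _ sh) /GRing.scale/= mulr1 (addrC h).
Unshelve. all: by end_near. Qed.

End laplace.

(** * Laws of independent triples *)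

Section independence.
Context d d1 d2 d3 (T : measurableType d) (T1 : measurableType d1)
  (T2 : measurableType d2) (T3 : measurableType d3) (R : realType)
  (P : probability T R).
Variables (X : {mfun T >-> T1}) (Y : {mfun T >-> T2}) (Z : {mfun T >-> T3}).

Hypothesis indep : forall A B C, measurable A -> measurable B -> measurable C ->
  P (X @^-1` A `&` Y @^-1` B `&` Z @^-1` C) =
  (P (X @^-1` A) * P (Y @^-1` B) * P (Z @^-1` C))%E.

(** Independence of [X] from the pair [(Y, Z)], and not only from rectangles:
    conditionally on an event of [X] of positive probability, the pair still
    has the product law, because it does so on rectangles. *)
Lemma indep_pair A S : measurable A -> measurable S ->
  P (X @^-1` A `&` [set w | S (Y w, Z w)]) =
  (P (X @^-1` A) * P [set w | S (Y w, Z w)])%E.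
Proof.
move=> mA mS.
have mXA : measurable (X @^-1` A) by rewrite -[X in measurable X]setTI; exact: measurable_funPT.
have mYZ : measurable_fun setT (fun w => (Y w, Z w)) by exact: measurable_fun_pair.
have mYZS : measurable [set w | S (Y w, Z w)].
  by rewrite -[X in measurable X]setTI; exact: mYZ.
have [PA0|PA0] := eqVneq (P (X @^-1` A)) 0%E.
  rewrite PA0 mul0e; apply/eqP; rewrite -measure_le0 -PA0.
  by apply: le_measure; rewrite ?inE//; exact: measurableI.
pose YZ : {mfun T >-> (T2 * T3)%type} := mfun_Sub (mem_set mYZ).
have Pfin : P (X @^-1` A) \is a fin_num by exact: fin_num_measure.
have r0 : 0 <= (fine (P (X @^-1` A)))^-1 by rewrite invr_ge0 fine_ge0.
pose m' : {measure set (T2 * T3)%type -> \bar R} :=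
  mscale (NngNum r0) (pushforward (mrestr P mXA) YZ).
have BC (B : set T2) (C : set T3) : measurable B -> measurable C ->
    P (Y @^-1` B `&` Z @^-1` C) = (P (Y @^-1` B) * P (Z @^-1` C))%E.
  move=> mB mC; have := indep measurableT mB mC.
  by rewrite preimage_setT setTI probability_setT mul1e.
have e1 := @product_measure_unique _ _ _ _ _ (distribution P Y) (distribution P Z)
  (m' mYZ) _ _ mS.
have e2 := @product_measure_unique _ _ _ _ _ (distribution P Y) (distribution P Z)
  (distribution P YZ) BC _ mS.
have <- : distribution P YZ S = P [set w | S (Y w, Z w)] by [].
have PAV : ((fine (P (X @^-1` A)))^-1%:E * P (X @^-1` A) = 1)%E.
  by rewrite -[in X in (_ * X)%E](fineK Pfin) -EFinM mulVf// fine_eq0.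
rewrite -e2 e1 /=; last first.
  move=> B C mB mC; rewrite /mscale/= /pushforward /mrestr.
  have -> : (fun w => (Y w, Z w)) @^-1` (B `*` C) `&` X @^-1` A =
      X @^-1` A `&` Y @^-1` B `&` Z @^-1` C by rewrite setIC -setIA.
  by rewrite indep// !muleA PAV mul1e.
rewrite /mscale/= /pushforward /mrestr [in RHS]setIC.
by rewrite muleCA muleA PAV mul1e.
Qed.

(** [(Y, Z)] may be integrated out last, with its two components frozen: this is
    what gives a meaning to the substitution of random parameters into an
    independent random function. *)
Lemma independent3_law S : measurable S ->
  P [set w | S (X w, (Y w, Z w))] =
  (\int[(distribution P Y \x distribution P Z)]_yz
     P [set w | S (X w, yz)])%E.
Proof.
move=> mS.
have mYZ : measurable_fun setT (fun w => (Y w, Z w)) by exact: measurable_fun_pair.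
pose YZ : {mfun T >-> (T2 * T3)%type} := mfun_Sub (mem_set mYZ).
have mXYZ : measurable_fun setT (fun w => (X w, YZ w)) by exact: measurable_fun_pair.
pose XYZ : {mfun T >-> (T1 * (T2 * T3))%type} := mfun_Sub (mem_set mXYZ).
have E : P [set w | S (X w, (Y w, Z w))] = (distribution P X \x^ distribution P YZ)%E S.
  rewrite -(@product_measure_unique _ _ _ _ _ (distribution P X) (distribution P YZ)
    (distribution P X \x^ distribution P YZ)%E)//.
    rewrite (@product_measure_unique _ _ _ _ _ (distribution P X) (distribution P YZ)
       (distribution P XYZ))//.
    by move=> A B mA mB; exact: indep_pair.
  by move=> A B mA mB; exact: product_measure2E.
rewrite E /product_measure2.
transitivity (\int[distribution P YZ]_yz P [set w | S (X w, yz)])%E.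
  apply: eq_integral => yz _; rewrite /= /distribution /pushforward; congr (P _).
  by apply/seteqP; split => w /=; rewrite /ysection/= inE.
apply: eq_measure_integral => A mA _; apply/esym.
apply: (@product_measure_unique _ _ _ _ _ (distribution P Y) (distribution P Z)
  (distribution P YZ)) mA => B C mB mC.
have := indep measurableT mB mC.
by rewrite preimage_setT setTI probability_setT mul1e.
Qed.
End independence.

(** * Integration against a density *)

(** The density is a Radon-Nikodym derivative, and these are unique almost
    everywhere. *)
Lemma integral_density d (T : measurableType d) (R : realType)
    (mu : {sigma_finite_measure set T -> \bar R}) (nu : {finite_measure set T -> \bar R})
    (g : T -> R) (f : T -> \bar R) :
  measurable_fun setT g ->
  (forall A, measurable A -> nu A = (\int[mu]_(x in A) (g x)%:E)%E) ->
  nu.-integrable setT f ->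
  (\int[nu]_x f x = \int[mu]_x (f x * (g x)%:E))%E.
Proof.
move=> mg nuE intf.
have dom : nu `<< mu.
  apply/null_content_dominatesP => A mA muA0; rewrite nuE//.
  by apply: null_set_integral => //; exact/measurable_EFinP/measurable_funTS.
rewrite -(Radon_Nikodym_change_of_variables dom)//=.
have mf := measurable_int _ intf.
apply: ae_eq_integral => //.
- exact: emeasurable_funM.
- by apply: emeasurable_funM => //; exact/measurable_EFinP.
- apply: (@ae_eqe_mul2l _ _ _ _ _ _ (EFin \o g) f); rewrite Radon_NikodymE/=.
  case: cid => /= h [h1 h2 h3].
  apply: integral_ae_eq => //=; first exact/measurable_EFinP.
  by move=> E _ mE; rewrite -h3//; exact: nuE.
Qed.

Lemma ae_iff_measure d (T : measurableType d) (R : realType)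
    (mu : {measure set T -> \bar R}) (A B : set T) :
  measurable A -> measurable B -> {ae mu, forall w, A w <-> B w} -> mu A = mu B.
Proof.
move=> mA mB AB.
rewrite -[A]setIT -[B]setIT -!integral_indic//.
apply: ae_eq_integral => //; try exact/measurable_EFinP/measurable_indic.
apply: filterS AB => w AB _.
by rewrite !indicE; have -> : (w \in A) = (w \in B) by apply/idP/idP; rewrite !inE => /AB.
Qed.

Lemma measurable_gamma_pdf (R : realType) (alpha p : R) :
  measurable_fun setT (gamma_pdf alpha p).
Proof.
apply: measurable_fun_if => //; first exact: measurable_fun_ltr.
apply: measurable_funM.
  by apply: measurable_funM => //; apply: measurable_funTS; exact: measurable_powR.
by apply: measurable_funTS; apply: measurableT_comp => //; exact: mulrl_measurable.
Qed.

(** * The law of the space fractional Polya process *)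

(** The process axioms only give measurability of the real-valued copy of a
    counting variable; subsets of [nat] are countable unions of points. *)
Lemma measurable_nat_valued d (T : measurableType d) (R : realType) (M : T -> nat) :
  measurable_fun setT (fun w => (M w)%:R : R) -> measurable_fun setT M.
Proof.
move=> mM _ B _; rewrite setTI.
have -> : M @^-1` B = \bigcup_(m in B) M @^-1` [set m].
  by apply/seteqP; split=> [w Bw|w [m Bm /= ->]//]; exists (M w).
apply: bigcup_measurable => m _.
have -> : M @^-1` [set m] = setT `&` (fun w => (M w)%:R : R) @^-1` [set m%:R].
  rewrite setTI; apply/seteqP; split=> w /=; first by move->.
  by move/eqP; rewrite eqr_nat => /eqP.
by apply: mM => //; exact: measurable_set1.
Qed.

Lemma sub_sigma_field_of d (T : measurableType d) (R : realType)
    (P : probability T R) (N : R -> R -> T -> nat) :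
  poisson_family P N -> sigma_field_of N `<=` measurable.
Proof.
move=> [hN _]; apply: smallest_sub; first exact: sigma_algebra_measurable.
move=> A [[u l]] [/= u0 l0] [B mB <-].
have [[mN _ _ _ _] _] := hN _ l0.
exact: (measurable_nat_valued (mN u u0)).
Qed.

(** At [u = 0] this is the point mass at [0], because [0 ^+ 0 = 1]; the law of a
    Poisson process at time [0] is thus covered. *)
Definition poisson_weight (R : realType) (n : nat) (u : R) : R :=
  u ^+ n / n`!%:R * expR (- u).

Lemma measurable_poisson_weight d (T : measurableType d) (R : realType) (n : nat)
    (f : T -> R) :
  measurable_fun setT f -> measurable_fun setT (poisson_weight n \o f).
Proof.
move=> mf; apply: measurable_funM.
  by apply: measurable_funM => //; exact: measurable_funX.
by apply: measurableT_comp => //; exact: measurableT_comp.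
Qed.

Lemma measurable_sigma_field_of d (T : measurableType d) (R : realType)
    (N : R -> R -> T -> nat) (A : set (g_sigma_algebraType (sigma_field_of N))) :
  measurable A -> sigma_field_of N A.
Proof. by rewrite /measurable/= /sigma_field_of /sigma_family sigma_algebra_id. Qed.

(** Positive times are part of the definition of a Poisson process; at time [0]
    the process vanishes almost surely. *)
Lemma poisson_family_pmf d (T : measurableType d) (R : realType)
    (P : probability T R) (N : R -> R -> T -> nat) (u l : R) (n : nat) :
  poisson_family P N -> 0 <= u -> 0 < l ->
  P [set w | N u l w = n] = (poisson_weight n (l * u))%:E.
Proof.
move=> hN u0 l0; have [sub pmf] := hN.1 _ l0.
have mN v : 0 <= v -> measurable_fun setT (N v l).
  by move=> v0; have [mN _ _ _ _] := sub; exact: measurable_nat_valued (mN v v0).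
have [u0'|u0'] := eqVneq u 0; last first.
  have up : 0 < u by rewrite lt_def u0' u0.
  by rewrite [LHS](pmf _ n up) /poisson_pmf /poisson_weight mulr_gt0.
rewrite u0' mulr0 /poisson_weight oppr0 expR0 mulr1 expr0n.
have [_ N0 _ _ _] := sub.
have mB : measurable [set w | N 0 l w = n].
  by rewrite -[X in measurable X]setTI; exact: (mN 0 (lexx _) measurableT [set n]).
have [n0|n0] := eqVneq n 0%N.
  rewrite n0 fact0 divr1 -(probability_setT P).
  apply: ae_iff_measure => //; first by rewrite -n0.
  by apply: filterS N0 => w /eqP; rewrite pnatr_eq0 => /eqP.
transitivity (P set0); last by rewrite measure0 mul0r.
apply: ae_iff_measure => //.
apply: filterS N0 => w /eqP; rewrite pnatr_eq0 => /eqP Nw; split => //= nN.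
by rewrite -nN Nw in n0.
Qed.

Section law.
Context d (T : measurableType d) (R : realType) (P : probability T R).
Variables (beta alpha p : R) (D : R -> T -> R) (N : R -> R -> T -> nat) (G : T -> R).
Hypotheses (b0 : 0 < beta).
Hypothesis hD : stable_subordinator P beta D.
Hypothesis hN : poisson_family P N.
Hypothesis hG : gamma_distributed P G alpha p.
Hypothesis hI : independent3 P (sigma_field_of N)
  (sigma_family [set t | 0 <= t] D) (preimage_set_system setT G measurable).

Lemma subordinator_ge0 (t : R) : 0 <= t -> {ae P, forall w, 0 <= D t w}.
Proof.
move=> t0; have [[_ D0 _ _ Dm] _] := hD.
by apply: filterS2 D0 Dm => w D0w [mono _]; rewrite -D0w; exact: mono.
Qed.

Lemma gamma_distributed_gt0 : {ae P, forall w, 0 < G w}.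
Proof.
have [mG GE] := hG.
exists (G @^-1` `]-oo, 0%R]); split.
- by rewrite -[X in measurable X]setTI; exact: mG.
- rewrite GE//; apply: integral0_eq => y; rewrite /= in_itv/= => y0.
  by rewrite /gamma_pdf ltNge y0.
- by move=> w /=; rewrite in_itv/= => /negP; rewrite -leNgt.
Qed.

Let mDt (t : R) (t0 : 0 <= t) : measurable_fun setT (D t).
Proof. by have [[mD _ _ _ _] _] := hD; exact: mD. Qed.

Definition stable_var (t : R) (t0 : 0 <= t) : {mfun T >-> R} := mfun_Sub (mem_set (mDt t0)).
Let mG : measurable_fun setT (G : T -> measurableTypeR R).
Proof. exact: hG.1. Qed.

(** The values are in the copy of [R] that carries Lebesgue measure, with respect
    to which the gamma law has its density. *)
Definition gamma_var : {mfun T >-> measurableTypeR R} :=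
  @mfun_Sub _ _ T (measurableTypeR R) G (mem_set mG).

Lemma stable_law_support (t : R) (t0 : 0 <= t) :
  distribution P (stable_var t0) (~` `[0%R, +oo[) = 0%E.
Proof.
rewrite /distribution/= /pushforward -(measure0 P); apply: ae_iff_measure => //.
  rewrite -[X in measurable X]setTI; apply: (mDt t0) => //.
  by apply: measurableC.
by apply: filterS (subordinator_ge0 t0) => w Dw; split=> //=; rewrite in_itv/= andbT Dw.
Qed.

Lemma stable_law_moment0 (t s : R) (t0 : 0 <= t) : 0 < s ->
  moment (distribution P (stable_var t0)) 0 s = expR (- (t * s `^ beta)).
Proof.
move=> s0; have [_ /(_ s t (ltW s0) t0)] := hD.
rewrite unlock => H.
have mf : measurable_fun setT (fun x : R => (expR (- (s * x)))%:E).
  apply/measurable_EFinP/measurableT_comp => //; apply: measurableT_comp => //.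
have : (\int[distribution P (stable_var t0)]_x (expR (- (s * x)))%:E)%E =
   (expR (- (t * s `^ beta)))%:E.
  by rewrite ge0_integral_distribution//= => x; rewrite lee_fin expR_ge0.
rewrite (ge0_negligible_integral _ _ _ _ (stable_law_support t0))//; last exact: measurableC.
rewrite setDE setTI setCK => {}H; rewrite /moment /Rintegral.
under eq_integral do rewrite expr0 mul1r.
by rewrite H.
Qed.


(** The event [N (time, rate) = n] in the product of the probability space of the
    family, carrying the sigma-algebra generated by the family alone, with the
    space of pairs. It is independence from that sigma-algebra that is assumed. *)
Definition time_rate_set (n : nat) : set (g_sigma_algebraType (sigma_field_of N) * (R * R)) :=
  [set x | time_rate x.2 /\ N x.2.1 x.2.2 x.1 = n].

Lemma measurable_time_rate : measurable [set x : R * R | time_rate x].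
Proof.
have -> : [set x : R * R | time_rate x] = `[0%R, +oo[%classic `*` `]0%R, +oo[%classic.
  by apply/seteqP; split => -[u l] /=; rewrite !in_itv/= !andbT.
exact: measurableX.
Qed.

Lemma measurable_time_rate_set (n : nat) : measurable (time_rate_set n).
Proof.
have mE : measurable [set x : g_sigma_algebraType (sigma_field_of N) * (R * R)
    | time_rate x.2].
  rewrite -[X in measurable X]setTI; apply: measurable_snd => //.
  exact: measurable_time_rate.
by have := hN.2 mE [set n]; apply.
Qed.

Lemma family_id_measurable : measurable_fun setT
  (id : T -> g_sigma_algebraType (sigma_field_of N)).
Proof.
by move=> _ A; rewrite setTI => /measurable_sigma_field_of; exact: sub_sigma_field_of hN A.
Qed.

(** A Poisson variable whose rate is [y] times a stable variable: the weight is a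
    multiple of the integrand of the [n]-th moment at [s = y]. *)
Lemma stable_law_weight (t y : R) (n : nat) (t0 : 0 <= t) : 0 < y ->
  (\int[distribution P (stable_var t0)]_(x in `[0%R, +oo[) (poisson_weight n (y * x))%:E)%E =
  (pexp (stable_poly beta n) (t * y `^ beta))%:E.
Proof.
move=> y0.
have M := @stable_moment R (distribution P (stable_var t0)) beta t n y b0
  (fun s s0 => stable_law_moment0 t0 s0) y0.
have I := moment_integrable (distribution P (stable_var t0)) n y0.
transitivity ((y ^+ n / n`!%:R)%:E * \int[distribution P (stable_var t0)]_(x in `[0%R, +oo[)
   ((EFin \o (fun x => x ^+ n * expR (- (y * x)))%R) x))%E.
  rewrite -integralZl//; apply: eq_integral => x _ /=.
  by rewrite -EFinM; congr (_%:E); rewrite /poisson_weight exprMn; ring.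
rewrite -[X in (_ * X)%E]fineK; last exact: integrable_fin_num.
rewrite -[fine _]/(moment (distribution P (stable_var t0)) n y) M -EFinM; congr (_%:E).
by field; rewrite pnatr_eq0 -lt0n fact_gt0 expf_neq0 ?gt_eqF.
Qed.


Lemma time_rate_set_prob (n : nat) (x y : R) :
  P [set w | time_rate_set n (w, (x, y))] =
  (if (0 <= x) && (0 < y) then poisson_weight n (y * x) else 0)%:E.
Proof.
case: ifPn => [/andP[x0 y0]|xy].
  rewrite -(poisson_family_pmf n hN x0 y0); congr (P _).
  by apply/seteqP; split => w /=; rewrite /time_rate_set/=; [case|].
transitivity (P set0); last by rewrite measure0.
congr (P _); apply/seteqP; split => w //=.
by rewrite /time_rate_set /time_rate /= => -[[x0 y0] _]; rewrite x0 y0 in xy.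
Qed.

(** The mass at [n] when the rate is [y], weighted by the gamma density of
    [y]. *)
Definition mixed_density (t : R) (n : nat) (y : R) : R :=
  pexp (stable_poly beta n) (t * y `^ beta) * gamma_pdf alpha p y.

(** The Poisson family is integrated out with time and rate frozen, then the
    stable variable, and the gamma variable is left. *)
Lemma sfpp_law (t : R) (n : nat) (W : {RV P >-> nat}) : 0 <= t ->
  {ae P, forall w, W w = N (D t w) (G w) w} ->
  P [set w | W w = n] = (\int[lebesgue_measure]_(y in `]0%R, +oo[) (mixed_density t n y)%:E)%E.
Proof.
move=> t0 WN.
pose X : {mfun T >-> g_sigma_algebraType (sigma_field_of N)} :=
  mfun_Sub (mem_set family_id_measurable).
have mS := measurable_time_rate_set n.
have -> : P [set w | W w = n] = P [set w | time_rate_set n (X w, (stable_var t0 w, gamma_var w))].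
  apply: ae_iff_measure.
  - rewrite -[X in measurable X]setTI.
    by apply: (@measurable_funPT _ _ _ _ W _ [set n]).
  - have mXYZ : measurable_fun setT (fun w => (X w, (stable_var t0 w, gamma_var w))).
      apply: measurable_fun_pair => //; exact: measurable_fun_pair.
    by rewrite -[X in measurable X]setTI; exact: mXYZ.
  - apply: filterS3 WN (subordinator_ge0 t0) gamma_distributed_gt0 => w Ww D0 G0 /=.
    by rewrite Ww /time_rate_set /=; split=> [|[_]].
rewrite independent3_law//; last first.
  move=> A B C mA mB mC; apply: hI.
  - exact: measurable_sigma_field_of.
  - by apply: sub_sigma_algebra; exists t => //; exists B => //; rewrite setTI.
  - by exists C => //; rewrite setTI.
pose q (xy : R * R) : \bar R :=
  (if (0 <= xy.1) && (0 < xy.2) then poisson_weight n (xy.2 * xy.1) else 0)%:E.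
have -> : (\int[(distribution P (stable_var t0) \x distribution P gamma_var)]_yz
   P [set w | time_rate_set n (X w, yz)])%E =
   (\int[(distribution P (stable_var t0) \x distribution P gamma_var)]_yz q yz)%E.
  by apply: eq_integral => -[x y] _; exact: time_rate_set_prob.
have q0 xy : (0 <= q xy)%E.
  rewrite /q lee_fin; case: ifPn => // /andP[x0 y0].
  by rewrite /poisson_weight !mulr_ge0 ?exprn_ge0 ?mulr_ge0 ?expR_ge0 ?(ltW y0).
have mq : measurable_fun setT q.
  apply/measurable_EFinP; apply: measurable_fun_if => //.
    by apply: measurable_and; [apply: measurable_fun_ler|apply: measurable_fun_ltr].
  by apply/measurable_funTS/measurable_poisson_weight; exact: measurable_funM.
rewrite fubini_tonelli2//=.
pose h (y : R) : R := if 0 < y then pexp (stable_poly beta n) (t * y `^ beta) else 0.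
have qh y : (\int[distribution P (stable_var t0)]_x q (x, y))%E = (h y)%:E.
  rewrite /h; case: ifPn => y0; last first.
    by apply: integral0_eq => x _; rewrite /q /= (negbTE y0) andbF.
  rewrite -(stable_law_weight n t0 y0) [RHS]integral_mkcond; apply: eq_integral => x _.
  rewrite /q /= y0 andbT patchE.
  case: (ifPn (x \in _)); rewrite ?inE ?notin_setE/= ?in_itv/= ?andbT.
    by move=> ->.
  by move=> /negP/negbTE ->.
rewrite /fubini_G; under eq_integral do rewrite qh.
have mh : measurable_fun setT h.
  apply: measurable_fun_if => //; first exact: measurable_fun_ltr.
  apply/measurable_funTS; apply: (@measurableT_comp _ _ _ _ _ _ (pexp (stable_poly beta n))).
    by apply: continuous_measurable_fun; exact: continuous_pexp.
  by apply: measurable_funM => //; exact: measurable_powR.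
have [M M0 hM] := pexp_bounded (stable_poly beta n).
have inth : (distribution P gamma_var).-integrable setT (EFin \o h).
  apply: measurable_bounded_integrable => //.
    by rewrite (le_lt_trans (probability_le1 _ _)) ?ltry.
  exists M; split; first exact: num_real.
  move=> M' MM' y _; apply: le_trans (ltW MM'); rewrite /h; case: ifPn => y0.
    by apply: hM; rewrite mulr_ge0// powR_ge0.
  by rewrite normr0.
rewrite (integral_density (nu := distribution P gamma_var) (measurable_gamma_pdf alpha p) hG.2 inth).
rewrite [RHS]integral_mkcond; apply: eq_integral => y _.
rewrite patchE; case: ifPn; rewrite ?inE ?notin_setE/= in_itv/= andbT.
  by move=> y0; rewrite -EFinM /h y0.
by move=> /negP/negbTE y0; rewrite /gamma_pdf y0 mule0.
Qed.

End law.

(** * Integration by primitives on the half-line *)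

Section halfline.
Variable R : realType.
Local Notation leb := (@lebesgue_measure R).
Local Notation halfline := (`]0%R, +oo[%classic : set R).

(** Compact intervals inside the open half-line. The index starts at [2] so
    that each interval is nondegenerate. *)
Definition exhaust (n : nat) : set R := `[n.+2%:R^-1, n.+2%:R]%classic.

Lemma bigcup_exhaust : \bigcup_n exhaust n = halfline.
Proof.
apply/seteqP; split => [y [n _]|y].
  rewrite /exhaust /= !in_itv/= andbT => /andP[+ _].
  by apply: lt_le_trans; rewrite invr_gt0 ltr0n.
rewrite /= in_itv/= andbT => y0.
have [n hn] : exists n : nat, Num.max y y^-1 < n%:R.
  by exists (Num.truncn (Num.max y y^-1)).+1; rewrite truncnS_gt.
move: hn; rewrite gt_max => /andP[yn yVn].
have n2 : n%:R <= n.+2%:R :> R by rewrite ler_nat -addn2 leq_addr.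
exists n => //; rewrite /exhaust/= in_itv/=; apply/andP; split.
  rewrite -[leRHS]invrK lef_pV2 ?posrE ?invr_gt0//.
  exact: le_trans (ltW yVn) n2.
exact: le_trans (ltW yn) n2.
Qed.

Lemma exhaust_gt0 (n : nat) (y : R) : exhaust n y -> 0 < y.
Proof.
rewrite /exhaust/= in_itv/= => /andP[+ _]; apply: lt_le_trans.
by rewrite invr_gt0 ltr0n.
Qed.

Lemma nd_exhaust : nondecreasing_seq exhaust.
Proof.
move=> m n mn; apply/subsetPset => y; rewrite /exhaust/= !in_itv/= => /andP[my ym].
have mn2 : m.+2%:R <= n.+2%:R :> R by rewrite ler_nat !ltnS.
apply/andP; split; last exact: le_trans mn2.
by apply: le_trans my; rewrite lef_pV2 ?posrE ?ltr0n.
Qed.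

Lemma measurable_halfline (f : R -> R) :
  (forall y, 0 < y -> {for y, continuous f}) -> measurable_fun halfline f.
Proof.
move=> cf; apply: open_continuous_measurable_fun; first exact: interval_open.
by move=> y; rewrite inE/= in_itv/= andbT; exact: cf.
Qed.

Lemma cvg_integral_exhaust (f : R -> R) :
  (forall y, 0 < y -> {for y, continuous f}) -> (forall y, 0 < y -> 0 <= f y) ->
  (\int[leb]_(y in exhaust n) (f y)%:E @[n --> \oo] -->
   \int[leb]_(y in halfline) (f y)%:E)%E.
Proof.
move=> cf f0; rewrite -bigcup_exhaust.
apply: ge0_nondecreasing_set_cvg_integral.
- exact: nd_exhaust.
- by move=> i; exact: measurable_itv.
- move=> n; apply/measurable_EFinP; apply: measurable_funS (measurable_halfline cf) => //.
  by move=> y /exhaust_gt0; rewrite /= in_itv/= andbT.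
- by move=> n y /exhaust_gt0/f0; rewrite lee_fin.
Qed.

Lemma integral_exhaust (f F : R -> R) (n : nat) :
  (forall y, 0 < y -> {for y, continuous f}) ->
  (forall y : R, 0 < y -> is_derive y 1 F (f y)) ->
  (\int[leb]_(y in exhaust n) (f y)%:E = (F n.+2%:R - F n.+2%:R^-1)%:E)%E.
Proof.
move=> cf dF.
have lo0 : 0 < n.+2%:R^-1 :> R by rewrite invr_gt0 ltr0n.
have cF y : 0 < y -> {for y, continuous F}.
  by move=> y0; apply/differentiable_continuous/derivable1_diffP; have [] := dF y y0.
have lohi : n.+2%:R^-1 < n.+2%:R :> R.
  by rewrite (@lt_trans _ _ 1)// ?invf_lt1 ?ltr0n ?ltr1n.
rewrite EFinB; apply: continuous_FTC2 => //.
- apply: continuous_in_subspaceT => y; rewrite inE/= in_itv/= => /andP[+ _].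
  by move=> /(lt_le_trans lo0)/cf.
- split.
  + move=> y; rewrite in_itv/= => /andP[/(lt_trans lo0) y0 _].
    by have [] := dF y y0.
  + by apply: cvg_at_right_filter; exact: cF.
  + by apply: cvg_at_left_filter; apply: cF; rewrite ltr0n.
- move=> y; rewrite in_itv/= => /andP[/(lt_trans lo0) y0 _].
  by rewrite derive1E; have [_ ->] := dF y y0.
Qed.

(** The integrals over the exhausting intervals are increments of a bounded
    primitive. The integrand may blow up at the origin. *)
Lemma bounded_primitive_integrable (f F : R -> R) (M : R) :
  (forall y, 0 < y -> {for y, continuous f}) -> (forall y, 0 < y -> 0 <= f y) ->
  (forall y : R, 0 < y -> is_derive y 1 F (f y)) ->
  (forall y, 0 < y -> 0 <= F y <= M) ->
  leb.-integrable halfline (EFin \o f).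
Proof.
move=> cf f0 dF FM; apply/integrableP; split.
  by apply/measurable_EFinP; apply: measurable_halfline.
have -> : (\int[leb]_(x in halfline) `|(EFin \o f) x|)%E =
    (\int[leb]_(x in halfline) (f x)%:E)%E.
  apply: eq_integral => y; rewrite inE/= in_itv/= andbT => /f0 fy.
  by rewrite ger0_norm.
apply: (@le_lt_trans _ _ M%:E); last by rewrite ltry.
have cvgf := cvg_integral_exhaust cf f0.
rewrite -(cvg_lim _ cvgf)//; apply: lime_le; first by apply/cvg_ex; eexists; exact: cvgf.
apply: nearW => n; rewrite (integral_exhaust n cf dF) lee_fin.
have /FM/andP[_ h1] : 0 < n.+2%:R :> R by rewrite ltr0n.
have /FM/andP[h2 _] : 0 < n.+2%:R^-1 :> R by rewrite invr_gt0 ltr0n.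
by rewrite (le_trans _ h1)// lerBlDr lerDl.
Qed.

(** Integration by parts on the open half-line when the boundary terms vanish:
    [F] is the product whose derivative is [f - g]. *)
Lemma Rintegral_eq_of_primitive (f g F : R -> R) :
  (forall y, 0 < y -> {for y, continuous f}) -> (forall y, 0 < y -> 0 <= f y) ->
  (forall y, 0 < y -> {for y, continuous g}) -> (forall y, 0 < y -> 0 <= g y) ->
  leb.-integrable halfline (EFin \o f) -> leb.-integrable halfline (EFin \o g) ->
  (forall y : R, 0 < y -> is_derive y 1 F (f y - g y)) ->
  F n.+2%:R @[n --> \oo] --> 0 -> F n.+2%:R^-1 @[n --> \oo] --> 0 ->
  \int[leb]_(y in halfline) f y = \int[leb]_(y in halfline) g y.
Proof.
move=> cf f0 cg g0 intf intg dF Foo F0.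
have cvgR (h : R -> R) : (forall y, 0 < y -> {for y, continuous h}) ->
    (forall y, 0 < y -> 0 <= h y) -> leb.-integrable halfline (EFin \o h) ->
    \int[leb]_(y in exhaust n) h y @[n --> \oo] --> \int[leb]_(y in halfline) h y.
  move=> ch h0 inth; apply: fine_cvg; rewrite fineK; last exact: integrable_fin_num.
  exact: cvg_integral_exhaust.
have sub n : exhaust n `<=` halfline.
  by move=> y /exhaust_gt0; rewrite /= in_itv/= andbT.
have En n : \int[leb]_(y in exhaust n) f y - \int[leb]_(y in exhaust n) g y =
    F n.+2%:R - F n.+2%:R^-1.
  rewrite -RintegralB; [|exact: measurable_itv|..].
  - rewrite /Rintegral (@integral_exhaust (fun y => f y - g y) F)//.
    by move=> y y0; apply: cvgB; [exact: cf|exact: cg].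
  - by apply: (@integrableS _ _ _ leb _ _ _ _ _ (@sub n) intf) => //; exact: measurable_itv.
  - by apply: (@integrableS _ _ _ leb _ _ _ _ _ (@sub n) intg) => //; exact: measurable_itv.
apply/eqP; rewrite -subr_eq0; apply/eqP.
have C1 := cvgB (cvgR f cf f0 intf) (cvgR g cg g0 intg).
have C2 := cvgB Foo F0.
rewrite subr0 in C2.
have e : (fun n => \int[leb]_(y in exhaust n) f y) - (fun n => \int[leb]_(y in exhaust n) g y)
    = (fun n : nat => F n.+2%:R) - (fun n => F n.+2%:R^-1).
  by apply/funext => n; exact: En.
rewrite e in C1.
by rewrite -(cvg_lim (@Rhausdorff R) (C1 eventually_filter)) -(cvg_lim (@Rhausdorff R) (C2 eventually_filter)).
Qed.

End halfline.

(** * The Gamma function *)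

Section gamma_function.
Variable R : realType.
Local Notation leb := (@lebesgue_measure R).
Local Notation halfline := (`]0%R, +oo[%classic : set R).

Lemma continuous_powR_gt0 (a y : R) : 0 < y -> {for y, continuous (@powR R ^~ a)}.
Proof.
move=> y0; apply/differentiable_continuous/derivable1_diffP.
by have [] := is_derive1_powR a y0.
Qed.

Lemma continuous_gamma_integrand (x c y : R) : 0 < y ->
  {for y, continuous (fun y : R => y `^ (x - 1) * expR (- (c * y)))}.
Proof.
move=> y0; apply: cvgM; first exact: continuous_powR_gt0.
apply: (@continuous_comp _ _ _ (fun y => - (c * y)) expR); last exact: continuous_expR.
apply: (@cvgN _ R^o); exact: mulrl_continuous.
Qed.

Lemma exprn_expR_bounded (m : nat) (c : R) : 0 < c ->
  exists C, forall y, 0 < y -> (1 + y) ^+ m * expR (- (c * y)) <= C.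
Proof.
move=> c0; exists (m`!%:R * expR c / c ^+ m) => y y0.
rewrite ler_pdivlMr ?exprn_gt0// mulrAC -exprMn expRN ler_pdivrMr ?expR_gt0//.
rewrite -mulrA -expRD (_ : c + c * y = (1 + y) * c); last by ring.
by apply: exprn_le_expR; rewrite mulr_ge0 ?addr_ge0 ?ltW.
Qed.

(** A beta prime density up to a constant. It behaves as [y^(x-1)] at the origin
    and is integrable at infinity, but unlike the gamma integrand it has an
    elementary primitive, [(y / (1 + y))^x / x]. *)
Definition beta_prime (x y : R) : R := y `^ (x - 1) * (1 + y) `^ (- x - 1).

Lemma is_derive_beta_prime (x y : R) : 0 < x -> 0 < y ->
  is_derive y 1 (fun y : R => x^-1 * (y `^ x * (1 + y) `^ (- x))) (beta_prime x y).
Proof.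
move=> x0 y0; have y1 : 0 < 1 + y by rewrite addr_gt0.
have d1 := is_derive1_powR x y0.
have d2 := @is_derive1_powR R (- x) (1 + y) y1.
have dl : is_derive y 1 (fun y : R => 1 + y) 1.
  have -> : (fun y : R => 1 + y) = cst 1 + id by [].
  by apply: is_derive_eq; rewrite add0r.
have d3 := @is_derive1_comp R (@powR R ^~ (- x)) (fun y : R => 1 + y) y _ _ d2 dl.
have H := is_deriveZ x^-1 (is_deriveM d1 d3).
apply: (is_derive_eq H); rewrite /GRing.scale/= /beta_prime.
have -> : y `^ x = y * y `^ (x - 1) by rewrite mulr_powRB1// ltW.
have -> : (1 + y) `^ (- x) = (1 + y) * (1 + y) `^ (- x - 1).
  have e : - x = 1 + (- x - 1) by ring.
  rewrite {1}e powRD ?powRr1 ?(ltW y1)//.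
  by rewrite (gt_eqF y1) implybT.
by field; rewrite gt_eqF.
Qed.

Lemma beta_prime_integrable (x : R) : 0 < x -> leb.-integrable halfline (EFin \o beta_prime x).
Proof.
move=> x0; apply: (@bounded_primitive_integrable _ _
  (fun y => x^-1 * (y `^ x * (1 + y) `^ (- x))) x^-1).
- move=> y y0; apply: cvgM; first exact: continuous_powR_gt0.
  apply: (@continuous_comp R R R (fun y => 1 + y) (@powR R ^~ (- x - 1)) y).
    by apply: cvgD; [exact: cvg_cst|exact: cvg_id].
  by apply: continuous_powR_gt0; rewrite addr_gt0.
- by move=> y y0; rewrite mulr_ge0 ?powR_ge0.
- by move=> y y0; exact: is_derive_beta_prime.
- move=> y y0; have y1 : 0 < 1 + y by rewrite addr_gt0.
  rewrite mulr_ge0 ?invr_ge0 ?(ltW x0) ?mulr_ge0 ?powR_ge0//=.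
  rewrite ler_piMr ?invr_ge0 ?(ltW x0)// powRN ler_pdivrMr ?powR_gt0// mul1r.
  by rewrite ge0_ler_powR ?nnegrE ?(ltW x0) ?(ltW y0) ?(ltW y1)// lerDr.
Qed.

(** Domination by a multiple of the beta prime density, as
    [(1 + y)^(x+1) e^(-c y)] is bounded. *)
Lemma gamma_integrand_integrable (x c : R) : 0 < x -> 0 < c ->
  leb.-integrable halfline (EFin \o (fun y : R => y `^ (x - 1) * expR (- (c * y)))).
Proof.
move=> x0 c0.
have [C hC] := exprn_expR_bounded (Num.truncn (x + 1)).+1 c0.
have iC : leb.-integrable halfline (EFin \o (fun y => C * beta_prime x y)).
  apply: (@eq_integrable _ _ _ leb _ _ (fun y => (C%:E * (EFin \o beta_prime x) y)%E)) => //.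
  by apply: integrableZl => //; exact: beta_prime_integrable.
apply: (@le_integrable _ _ _ leb _ _ _ _ _ _ iC) => //.
  apply/measurable_EFinP; apply: measurable_halfline => y.
  exact: continuous_gamma_integrand.
move=> y; rewrite /= in_itv/= andbT => y0; have y1 : 0 < 1 + y by rewrite addr_gt0.
rewrite lee_fin ger0_norm ?mulr_ge0 ?powR_ge0 ?expR_ge0//.
apply: le_trans (ler_norm _); rewrite /beta_prime mulrCA ler_wpM2l ?powR_ge0//.
have := hC _ y0; rewrite -powR_mulrn ?(ltW y1)// => {}hC.
rewrite (_ : - x - 1 = - (x + 1)); last by ring.
rewrite powRN ler_pdivlMr ?powR_gt0// mulrC.
apply: le_trans hC; rewrite ler_wpM2r ?expR_ge0//.
by apply: ler_powR; [rewrite lerDl ltW|rewrite ltW// truncnS_gt].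
Qed.

(** Otherwise the integrand, which is positive, would vanish almost
    everywhere. *)
Lemma Gamma_gt0 (x : R) : 0 < x -> 0 < Gamma x.
Proof.
move=> x0; have int := gamma_integrand_integrable x0 ltr01.
have E : Gamma x = \int[leb]_(y in halfline) (y `^ (x - 1) * expR (- (1 * y))).
  by rewrite /Gamma; apply: eq_Rintegral => y _; rewrite mul1r.
rewrite lt_def E Rintegral_ge0; last by move=> y _; rewrite mulr_ge0 ?powR_ge0 ?expR_ge0.
rewrite andbT; apply/negP => /eqP J0.
have If : (\int[leb]_(y in halfline) (y `^ (x - 1) * expR (- (1 * y)))%:E)%E \is a fin_num.
  exact: integrable_fin_num.
have I0 := congr1 EFin J0; rewrite /Rintegral fineK// in I0.
have mf := measurable_int _ int.
have : ae_eq leb halfline (EFin \o (fun y : R => y `^ (x - 1) * expR (- (1 * y)))) (cst 0%E).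
  have mh : measurable (halfline : set (measurableTypeR R)) by exact: measurable_itv.
  apply/(ae_eq_integral_abs leb mh mf).
  rewrite -[RHS]I0; apply: eq_integral => y _ /=.
  by rewrite ger0_norm// mulr_ge0 ?powR_ge0 ?expR_ge0.
case=> M [mM M0 subM].
have : (leb halfline <= leb M)%E.
  apply: le_measure; rewrite ?inE//.
  move=> y Dy; apply: subM => /= /(_ Dy) [] /eqP; rewrite mulf_eq0 expR_eq0 orbF.
  by rewrite gt_eqF// powR_gt0//; move: Dy; rewrite /= in_itv/= andbT.
by rewrite M0 lebesgue_measure_itv/= ltry.
Qed.

Lemma cvg_invSSn : (n.+2%:R^-1 : R) @[n --> \oo] --> (0 : R).
Proof.
have := @cvg_harmonic R; rewrite -(cvg_shiftn 1).
by apply: cvg_trans; apply: near_eq_cvg; apply: nearW => n; rewrite /= addn1.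
Qed.

(** Integration by parts with [F(y) = y^x e^(-y)]. *)
Lemma GammaS (x : R) : 0 < x -> Gamma (x + 1) = x * Gamma x.
Proof.
move=> x0; have x10 : 0 < x + 1 by rewrite addr_gt0.
have int1 := gamma_integrand_integrable x0 ltr01.
have int2 := gamma_integrand_integrable x10 ltr01.
have c1 := @continuous_gamma_integrand x 1.
have c2 := @continuous_gamma_integrand (x + 1) 1.
have E z : Gamma z = \int[leb]_(y in halfline) (y `^ (z - 1) * expR (- (1 * y))).
  by rewrite /Gamma; apply: eq_Rintegral => y _; rewrite mul1r.
rewrite !E -RintegralZl//; apply/esym.
have intx : leb.-integrable halfline (EFin \o (fun y : R => x * (y `^ (x - 1) * expR (- (1 * y))))).
  apply: (@eq_integrable _ _ _ leb _ _ (fun y => (x%:E * (EFin \o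
    (fun y : R => (y `^ (x - 1) * expR (- (1 * y)))%R)) y)%E)) => //.
  exact: integrableZl.
pose F (y : R) := y `^ x * expR (- (1 * y)).
apply: (@Rintegral_eq_of_primitive R _ _ F) => //.
- by move=> y y0; apply: cvgM; [exact: cvg_cst|exact: c1].
- by move=> y y0; rewrite !mulr_ge0 ?powR_ge0 ?expR_ge0 ?(ltW x0).
- by move=> y y0; rewrite !mulr_ge0 ?powR_ge0 ?expR_ge0.
- move=> y y0; have d1 := is_derive1_powR x y0.
  have dl : is_derive y 1 (fun y : R => - (1 * y)) (-1).
    have -> : (fun y : R => - (1 * y)) = - (@id R).
      by apply/funext => z; rewrite mul1r.
    exact: is_derive_eq.
  have d2 := @is_derive1_comp R expR _ y _ _ (is_derive_expR _) dl.
  apply: (is_derive_eq (is_deriveM d1 d2)); rewrite /GRing.scale/= addrK; ring.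
- pose m := Num.truncn x.
  apply: (@squeeze_cvgr _ _ _ _ (cst 0) (fun n => (m.+2)`!%:R * n.+2%:R^-1)).
  + apply: nearW => n; rewrite mulr_ge0 ?powR_ge0 ?expR_ge0//= /F mul1r.
    rewrite expRN ler_pdivrMr ?expR_gt0// mulrAC ler_pdivlMr ?ltr0n//.
    apply: le_trans (_ : n.+2%:R ^+ m.+2 <= _); last exact: exprn_le_expR.
    rewrite exprSr ler_wpM2r// -powR_mulrn//; apply: ler_powR; first by rewrite ler1n.
    by rewrite ltW// truncnS_gt.
  + exact: cvg_cst.
  + by rewrite -[X in _ --> X](mulr0 (m.+2)`!%:R); apply: cvgM; [exact: cvg_cst|exact: cvg_invSSn].
- apply: (@squeeze_cvgr _ _ _ _ (cst 0) (fun n => (n.+2%:R^-1) `^ x)).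
  + apply: nearW => n; rewrite mulr_ge0 ?powR_ge0 ?expR_ge0//= /F.
    by rewrite ler_piMr ?powR_ge0// mul1r expR_le1 oppr_le0 invr_ge0.
  + exact: cvg_cst.
  + have /cvg_at_rightP := powR_cvg0 x0; apply; split; last exact: cvg_invSSn.
    by move=> n; rewrite invr_gt0 ltr0n.
Qed.

Lemma Gamma1 : Gamma 1 = 1 :> R.
Proof.
have dF (y : R) : is_derive y 1 (fun y : R => - expR (- y)) (expR (- y)).
  have d2 := @is_derive1_comp R expR -%R y _ _ (is_derive_expR _) (is_deriveNid _ _).
  apply: (is_derive_eq (is_deriveN d2)); ring.
have cE : continuous (fun y : R => expR (- y)).
  move=> y; apply: (@continuous_comp R R R -%R expR); last exact: continuous_expR.
  exact: (@cvgN _ R^o).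
have -> : Gamma 1 = \int[leb]_(y in halfline) expR (- y).
  by rewrite /Gamma; apply: eq_Rintegral => y _; rewrite subrr powRr0 mul1r.
rewrite /Rintegral integral_itv_obnd_cbnd; last first.
  by apply/measurable_EFinP; apply: measurable_funTS; exact: continuous_measurable_fun.
rewrite (@ge0_continuous_FTC2y _ _ (fun y : R => - expR (- y)) 0 0)//.
- by rewrite oppr0 expR0 sub0e /= opprK.
- exact: continuous_subspaceT.
- by rewrite -oppr0; apply: cvgN; exact: cvgr_expR.
- by apply: cvg_at_right_filter; apply: cvgN; exact: cE.
- by move=> y _; rewrite derive1E; have [_ ->] := dF y.
Qed.

End gamma_function.

(** * The fractional difference as a finite sum *)

Lemma Gamma_fact (R : realType) (r : nat) : Gamma (r.+1%:R) = r`!%:R :> R.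
Proof.
elim: r => [|r IH]; first by rewrite Gamma1.
by rewrite -[r.+2%:R]natr1 GammaS ?ltr0n// IH factS natrM.
Qed.

(** The functional equation of Gamma makes the value independent of the shift
    [m], as long as it brings the argument to the right of the origin; so the
    shift can be chosen to suit the argument. *)
Lemma rGammaE (R : realType) (x : R) (m : nat) : 0 < x + m%:R ->
  rGamma x = (\prod_(i < m) (x + i%:R)) / Gamma (x + m%:R).
Proof.
pose G (m : nat) := (\prod_(i < m) (x + i%:R)) / Gamma (x + m%:R).
have GD (a k : nat) : 0 < x + a%:R -> G (a + k)%N = G a.
  move=> xa; elim: k => [|k IH]; first by rewrite addn0.
  have xak : 0 < x + (a + k)%:R by rewrite natrD addrA ltr_wpDr.
  rewrite -IH /G addnS big_ord_recr/= -natr1 addrA GammaS//.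
  by rewrite invfM mulrA mulfK ?gt_eqF.
move=> xm; rewrite -/(G m) /rGamma.
set m0 := (if _ then _ else _); rewrite -/(G m0).
have xm0 : 0 < x + m0%:R.
  rewrite /m0; case: ifPn => [x0|]; first by rewrite addr0.
  rewrite -leNgt => x0.
  have fx : (Num.floor x <= 0)%R by rewrite -(floor0 R); exact: le_floor.
  rewrite -natr1 (_ : (`|Num.floor x|%N)%:R = - (Num.floor x)%:~R :> R); last first.
    by rewrite -[LHS]/((`|Num.floor x|%N)%:Z%:~R) abszE ler0_norm// mulrNz.
  have := floor_le x; have := floorD1_gt x; rewrite intrD => h1 h2.
  by rewrite addrA ltr_wpDl// subr_ge0.
by rewrite -(GD m0 m)// addnC GD.
Qed.

(** The shift [r] brings [beta - r + 1] to [beta + 1], uniformly in [r]; the two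
    factors Gamma (beta + 1) cancel and a falling factorial is left. *)
Lemma frac_coefE (R : realType) (beta : R) (r : nat) : 0 < beta ->
  Gamma (beta + 1) / Gamma (r.+1%:R) * rGamma (beta - r%:R + 1) * (-1) ^+ r
  = diff_coef beta r.
Proof.
move=> b0; have b1 : 0 < beta + 1 by rewrite addr_gt0.
have e : beta - r%:R + 1 + r%:R = beta + 1 by ring.
rewrite (@rGammaE R _ r) ?e// Gamma_fact.
transitivity ((-1) ^+ r * (\prod_(i < r) (beta - r%:R + 1 + i%:R)) / r`!%:R).
  have r0 : r`!%:R != 0 :> R by rewrite pnatr_eq0 -lt0n fact_gt0.
  by field; rewrite r0 gt_eqF// Gamma_gt0.
elim: r {e} => [|r IH].
  by rewrite big_ord0 /diff_coef fact0 expr0; field.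
rewrite /diff_coef -/(diff_coef beta r) -IH big_ord_recl/= factS natrM exprS.
have r0 : r`!%:R != 0 :> R by rewrite pnatr_eq0 -lt0n fact_gt0.
have r1 : r.+1%:R != 0 :> R by rewrite pnatr_eq0.
have -> : \prod_(i < r) (beta - r.+1%:R + 1 + (bump 0 i)%:R) =
    \prod_(i < r) (beta - r%:R + 1 + i%:R).
  by apply: eq_bigr => i _; rewrite /bump/= add1n -!natr1; ring.
by rewrite -!natr1; field; rewrite r0 natr1.
Qed.

Lemma iter_backshift (R : realType) (r : nat) (u : int -> R) (n : int) :
  iter r (@backshift R) u n = u (n - r%:Z).
Proof.
elim: r n => [|r IH] n; first by rewrite subr0.
by rewrite iterS /backshift IH; congr u; lia.
Qed.

Section frac_diff.
Variables (R : realType) (beta : R).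
Hypothesis b0 : 0 < beta.
Variable u : int -> R.
Hypothesis u0 : forall n, n < 0 -> u n = 0.

(** On sequences that vanish at negative integers the series is eventually
    constant. *)
Lemma frac_diff_nat (n : nat) :
  frac_diff beta u n%:Z = \sum_(r < n.+1) diff_coef beta r * u (n - r)%N%:Z.
Proof.
rewrite /frac_diff; apply: cvg_lim => //.
apply: cvg_near_cst; exists n.+1 => // N /= nN.
transitivity (\sum_(r < N) diff_coef beta r * u (n%:Z - r%:Z)).
  rewrite /series/= big_mkord; apply: eq_bigr => r _.
  by rewrite -(frac_coefE _ b0) iter_backshift.
rewrite -(subnKC nN) big_split_ord/= [X in _ + X]big1 ?addr0.
  by apply: eq_bigr => r _; congr (_ * u _); have := ltn_ord r; lia.
by move=> r _; rewrite u0 ?mulr0//; lia.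
Qed.

Lemma frac_diff_neg (n : int) : n < 0 -> frac_diff beta u n = 0.
Proof.
move=> n0; rewrite /frac_diff; apply: cvg_lim => //.
apply: cvg_near_cst; apply: nearW => N /=.
by rewrite /series/= big1// => r _; rewrite iter_backshift u0 ?mulr0//; lia.
Qed.
End frac_diff.

Lemma sfpp_op_pow_neg (R : realType) (beta alpha p : R) (k : nat) (u : int -> R) :
  0 < beta -> (forall n, n < 0 -> u n = 0) ->
  forall n, n < 0 -> sfpp_op_pow beta alpha p k u n = 0.
Proof.
move=> b0; elim: k p => [|k IH] p u0 n n0 /=; first exact: u0.
rewrite /sfpp_op frac_diff_neg//; first by rewrite !mul0r oppr0.
exact: IH.
Qed.

(** * Time derivatives of the mass function *)

(** The difference quotient at [t] only looks at increments [h] with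
    [0 <= t + h]. *)
Lemma is_derive_ge0_ext (R : realType) (f g f' : R -> R) :
  (forall t, 0 <= t -> f t = g t) -> is_derive_ge0 f f' -> is_derive_ge0 g f'.
Proof.
move=> fg df t t0; apply: cvg_trans (df t t0); apply: near_eq_cvg.
by near=> h; rewrite !fg//; near: h; exact: near_withinT.
Unshelve. all: by end_near. Qed.

Lemma is_nderive_ge0_ext (R : realType) (k : nat) (f f' g g' : R -> R) :
  (forall t, 0 <= t -> f t = f' t) -> (forall t, 0 <= t -> g t = g' t) ->
  is_nderive_ge0 k f g -> is_nderive_ge0 k f' g'.
Proof.
elim: k f f' => [|k IH] f f' ff' gg' /=.
  by move=> fg t t0; rewrite -ff'// fg// gg'.
move=> [h dh nh]; exists h; first exact: is_derive_ge0_ext dh.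
exact: IH nh.
Qed.

Lemma is_nderive_ge0D (R : realType) (k : nat) (f1 g1 f2 g2 : R -> R) :
  is_nderive_ge0 k f1 g1 -> is_nderive_ge0 k f2 g2 ->
  is_nderive_ge0 k (fun t => f1 t + f2 t) (fun t => g1 t + g2 t).
Proof.
elim: k f1 f2 => [|k IH] f1 f2 /=.
  by move=> h1 h2 t t0; rewrite h1// h2.
move=> [h1 d1 n1] [h2 d2 n2]; exists (fun t => h1 t + h2 t); last exact: IH.
move=> t t0; have := cvgD (d1 t t0) (d2 t t0).
move=> /(_ _); apply: cvg_trans; apply: near_eq_cvg; apply: nearW => h.
rewrite -[LHS]/(h^-1 * (f1 (t + h) - f1 t) + h^-1 * (f2 (t + h) - f2 t)); ring.
Qed.

Lemma is_nderive_ge0Z (R : realType) (k : nat) (c : R) (f g : R -> R) :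
  is_nderive_ge0 k f g -> is_nderive_ge0 k (fun t => c * f t) (fun t => c * g t).
Proof.
elim: k f => [|k IH] f /=; first by move=> fg t t0; rewrite fg.
move=> [h d n]; exists (fun t => c * h t); last exact: IH.
move=> t t0; have := cvgMl_tmp (a := c) (d t t0).
move=> /(_ _); apply: cvg_trans; apply: near_eq_cvg; apply: nearW => u.
rewrite -[LHS]/(c * (u^-1 * (f (t + u) - f t))); ring.
Qed.

Lemma is_nderive_ge0_sum (R : realType) (k N : nat) (c : nat -> R) (f g : nat -> R -> R) :
  (forall i, is_nderive_ge0 k (f i) (g i)) ->
  is_nderive_ge0 k (fun t => \sum_(i < N) c i * f i t) (fun t => \sum_(i < N) c i * g i t).
Proof.
move=> fg; elim: N => [|N IH].
  apply: (@is_nderive_ge0_ext _ _ (fun t => 0 * f 0%N t) _ (fun t => 0 * g 0%N t)).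
  - by move=> t _; rewrite big_ord0 mul0r.
  - by move=> t _; rewrite big_ord0 mul0r.
  - exact: is_nderive_ge0Z.
apply: (is_nderive_ge0_ext _ _ (is_nderive_ge0D IH (is_nderive_ge0Z (c N) (fg N)))).
  by move=> t _; rewrite big_ord_recr.
by move=> t _; rewrite big_ord_recr.
Qed.

Lemma Rintegral_sum d (T : measurableType d) (R : realType)
    (mu : {measure set T -> \bar R}) (D : set T) (n : nat) (c : nat -> R)
    (f : nat -> T -> R) : measurable D ->
  (forall i, mu.-integrable D (EFin \o f i)) ->
  mu.-integrable D (EFin \o (fun x => \sum_(i < n) c i * f i x)) /\
  \int[mu]_(x in D) (\sum_(i < n) c i * f i x) =
  \sum_(i < n) c i * \int[mu]_(x in D) f i x.
Proof.
move=> mD intf; elim: n => [|n [IHi IH]].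
  split.
    apply: (eq_integrable mD (cst 0%E)) => [x _|]; first by rewrite /= big_ord0.
    exact: integrable0.
  rewrite big_ord0 (@eq_Rintegral _ _ _ _ _ (cst 0)) ?Rintegral_cst ?mul0r//.
  by move=> x _; rewrite big_ord0.
have intc : mu.-integrable D (EFin \o (fun x => c n * f n x)).
  by apply: (eq_integrable mD (fun x => ((c n)%:E * (EFin \o f n) x)%E)) => //;
    exact: integrableZl.
split.
  apply: (eq_integrable mD (fun x => ((EFin \o (fun x => \sum_(i < n) c i * f i x)%R) x +
     (EFin \o (fun x => c n * f n x)%R) x)%E)); last exact: integrableD.
  by move=> x _; rewrite /= big_ord_recr/= EFinD.
rewrite big_ord_recr/= -IH -RintegralZl// -RintegralD//.
by apply: eq_Rintegral => x _; rewrite big_ord_recr.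
Qed.

Lemma pexp_twist_stable_poly (R : realType) (beta : R) (n : nat) (w : R) :
  pexp (twist (stable_poly beta n)) w =
  - \sum_(r < n.+1) diff_coef beta r * pexp (stable_poly beta (n - r)) w.
Proof.
rewrite {1}/pexp twist_stable_poly hornerN horner_sum mulrN mulr_sumr; congr (- _).
by apply: eq_bigr => r _; rewrite hornerZ /pexp; ring.
Qed.

Section time_derivative.
Variables (R : realType) (beta alpha : R).
Hypotheses (b0 : 0 < beta) (a0 : 0 < alpha).
Local Notation leb := (@lebesgue_measure R).
Local Notation halfline := (`]0%R, +oo[%classic : set R).

(** The candidate mass function, defined for every [p] whether or not a process
    with that parameter is at hand: iterating the equation goes through the
    intermediate parameters [p + j beta]. *)
Definition polya_pmf (p : R) (n : nat) (t : R) : R :=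
  \int[leb]_(y in halfline) mixed_density beta alpha p t n y.

(** The gamma densities with parameters [p] and [p + b] differ by a power of [y]
    and by normalization; this shift of the parameter is the source of the
    constant in the operator. *)
Lemma gamma_pdfM (p b y : R) : 0 < p -> 0 <= b -> 0 < y ->
  y `^ b * gamma_pdf alpha p y
  = Gamma (p + b) / (alpha `^ b * Gamma p) * gamma_pdf alpha (p + b) y.
Proof.
move=> p0 b'0 y0; rewrite /gamma_pdf y0.
have G1 := Gamma_gt0 p0; have G2 : 0 < Gamma (p + b) by rewrite Gamma_gt0 ?ltr_wpDr.
have A : alpha `^ (p + b) = alpha `^ p * alpha `^ b.
  by rewrite powRD// (gt_eqF a0) implybT.
have Y : y `^ (p + b - 1) = y `^ b * y `^ (p - 1).
  by rewrite -powRD ?(gt_eqF y0) ?implybT//; congr (_ `^ _); ring.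
have Ab := powR_gt0 b a0.
rewrite A Y; move: (Gamma p) (Gamma (p + b)) G1 G2 => g1 g2 G1 G2.
by field; rewrite !gt_eqF.
Qed.

Lemma gamma_pdf_integrable (p : R) : 0 < p ->
  leb.-integrable halfline (EFin \o gamma_pdf alpha p).
Proof.
move=> p0.
apply: (@eq_integrable _ _ _ leb _ _ (fun y => ((alpha `^ p / Gamma p)%:E *
    (EFin \o (fun y : R => (y `^ (p - 1) * expR (- (alpha * y)))%R)) y)%E)) => [//|y|].
  by rewrite inE/= in_itv/= andbT => y0; rewrite /gamma_pdf y0 -EFinM mulrA mulNr.
by apply: integrableZl => //; exact: gamma_integrand_integrable.
Qed.

Lemma gamma_moment_integrable (p b : R) : 0 < p -> 0 <= b ->
  leb.-integrable halfline (EFin \o (fun y : R => y `^ b * gamma_pdf alpha p y)).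
Proof.
move=> p0 b'0.
apply: (@eq_integrable _ _ _ leb _ _ (fun y => ((Gamma (p + b) / (alpha `^ b * Gamma p))%:E *
    (EFin \o gamma_pdf alpha (p + b)) y)%E)) => [//|y|].
  by rewrite inE/= in_itv/= andbT => y0; rewrite -EFinM -gamma_pdfM.
by apply: integrableZl => //; apply: gamma_pdf_integrable; rewrite ltr_wpDr.
Qed.

(** A bounded factor times a gamma moment. *)
Lemma pexp_mixed_integrable (q : {poly R}) (p b t : R) : 0 < p -> 0 <= b -> 0 <= t ->
  leb.-integrable halfline
    (EFin \o (fun y : R => pexp q (t * y `^ beta) * (y `^ b * gamma_pdf alpha p y))).
Proof.
move=> p0 b'0 t0; have [M M0 hM] := pexp_bounded q.
have int := gamma_moment_integrable p0 b'0.
apply: (@eq_integrable _ _ _ leb _ _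
  ((EFin \o (fun y : R => pexp q (t * y `^ beta))) \*
   (EFin \o (fun y : R => (y `^ b * gamma_pdf alpha p y)%R)))%E) => //.
apply: integrableMr => //.
  apply: measurable_funTS; apply: (@measurableT_comp _ _ _ _ _ _ (pexp q)).
    by apply: continuous_measurable_fun; exact: continuous_pexp.
  by apply: measurable_funM => //; exact: measurable_powR.
exists M; split; first exact: num_real.
move=> M' MM' y _; apply: le_trans (ltW MM').
by apply: hM; rewrite mulr_ge0// powR_ge0.
Qed.

Lemma mixed_integrable (p t : R) (n : nat) : 0 < p -> 0 <= t ->
  leb.-integrable halfline (EFin \o mixed_density beta alpha p t n).
Proof.
move=> p0 t0; have := pexp_mixed_integrable (stable_poly beta n) p0 (lexx 0) t0.
by congr (_.-integrable _ _); apply/funext => y; rewrite /= powRr0 mul1r.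
Qed.

(** The derivative of [e^(-w) Q_n(w)] at [w = t y^beta] in [t] produces the
    factor [y^beta], absorbed by the gamma density, and minus the convolution
    of the coefficients of [(1 - z)^beta] with the masses up to [n]. The error
    of the first-order expansion is bounded by [h^2] times a gamma moment of
    order [2 beta], uniformly down to [t = 0]. *)
Lemma polya_pmf_derive (p : R) (n : nat) : 0 < p ->
  is_derive_ge0 (polya_pmf p n) (fun t => - (Gamma (p + beta) / (alpha `^ beta * Gamma p)) *
     \sum_(r < n.+1) diff_coef beta r * polya_pmf (p + beta) (n - r) t).
Proof.
move=> p0 t t0; have [C C0 hC] := pexp_taylor (stable_poly beta n).
set K := Gamma _ / _.
have pb0 : 0 < p + beta by rewrite addr_gt0.
have bb0 : 0 <= beta + beta by rewrite addr_ge0// ltW.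
have mh : measurable (halfline : set (measurableTypeR R)) by exact: measurable_itv.
have [iS Es] := @Rintegral_sum _ _ _ leb halfline n.+1 (diff_coef beta)
  (fun r => mixed_density beta alpha (p + beta) t (n - r)) mh
  (fun r => mixed_integrable (n - r) pb0 t0).
have intS := pexp_mixed_integrable (twist (stable_poly beta n)) p0 (ltW b0) t0.
have F'E : - K * (\sum_(r < n.+1) diff_coef beta r * polya_pmf (p + beta) (n - r) t) =
    \int[leb]_(y in halfline)
      (pexp (twist (stable_poly beta n)) (t * y `^ beta) * (y `^ beta * gamma_pdf alpha p y)).
  rewrite /polya_pmf -Es -(RintegralZl _ mh iS); apply: eq_Rintegral => y.
  rewrite inE/= in_itv/= andbT => y0.
  rewrite gamma_pdfM// ?(ltW b0)// -/K pexp_twist_stable_poly mulr_sumr mulNr mulr_suml -sumrN.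
  by apply: eq_bigr => r _; rewrite /mixed_density; ring.
rewrite F'E.
apply: (@cvg_diff_quotient _ _ _ _ _
  (C * \int[leb]_(y in halfline) (y `^ (beta + beta) * gamma_pdf alpha p y)) 1) => // h /= th _.
rewrite mulrAC.
apply: (Rintegral_taylor _ (mixed_integrable n p0 t0) (mixed_integrable n p0 th) intS
  (gamma_moment_integrable p0 bb0)) => // y; rewrite /= in_itv/= andbT => y0.
rewrite /mixed_density; set w := t * _; set w' := (t + h) * _.
have g0 : 0 <= gamma_pdf alpha p y.
  by rewrite /gamma_pdf y0 !mulr_ge0 ?powR_ge0 ?expR_ge0 ?invr_ge0 ?(ltW (Gamma_gt0 p0)).
have -> : pexp (stable_poly beta n) w' * gamma_pdf alpha p y -
    pexp (stable_poly beta n) w * gamma_pdf alpha p y -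
    h * (pexp (twist (stable_poly beta n)) w * (y `^ beta * gamma_pdf alpha p y)) =
   (pexp (stable_poly beta n) w' - pexp (stable_poly beta n) w
    - (w' - w) * pexp (twist (stable_poly beta n)) w) * gamma_pdf alpha p y.
  by rewrite /w' /w; ring.
rewrite normrM (ger0_norm g0).
have -> : C * h ^+ 2 * (y `^ (beta + beta) * gamma_pdf alpha p y) =
    C * (w' - w) ^+ 2 * gamma_pdf alpha p y.
  by rewrite powRD ?(gt_eqF y0) ?implybT// /w' /w; ring.
by rewrite ler_wpM2r// hC// mulr_ge0// powR_ge0.
Qed.

Definition polya_pmfz (p t : R) (m : int) : R := if m is Posz j then polya_pmf p j t else 0.

(** One derivative raises [p] to [p + beta] and produces a finite linear
    combination of masses, to which the induction hypothesis applies term by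
    term at the new parameter. *)
Lemma polya_pmf_nderive (k : nat) (p : R) (n : nat) : 0 < p ->
  is_nderive_ge0 k (polya_pmf p n)
    (fun t => sfpp_op_pow beta alpha p k (polya_pmfz (p + k%:R * beta) t) n%:Z).
Proof.
elim: k p n => [|k IH] p n p0 /=; first by move=> t _; rewrite mul0r addr0.
have pb0 : 0 < p + beta by rewrite addr_gt0.
exists (fun t => - (Gamma (p + beta) / (alpha `^ beta * Gamma p)) *
     \sum_(r < n.+1) diff_coef beta r * polya_pmf (p + beta) (n - r) t).
  exact: polya_pmf_derive.
have := is_nderive_ge0Z (- (Gamma (p + beta) / (alpha `^ beta * Gamma p)))
  (is_nderive_ge0_sum n.+1 (diff_coef beta) (fun r => IH (p + beta) (n - r)%N pb0)).
apply: is_nderive_ge0_ext => // t t0.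
rewrite /sfpp_op frac_diff_nat//; last first.
  move=> m m0; apply: sfpp_op_pow_neg => //.
  by case.
have e : p + beta + k%:R * beta = p + k.+1%:R * beta by rewrite -natr1; ring.
by rewrite mulNr mulrC e -[in RHS]mulrA.
Qed.

Lemma polya_pmf0 (p : R) (n : nat) : 0 < p ->
  \int[leb]_(y in halfline) gamma_pdf alpha p y = 1 ->
  polya_pmf p n 0 = (n == 0%N)%:R.
Proof.
move=> p0 g1; have -> : polya_pmf p n 0 =
    \int[leb]_(y in halfline) (pexp (stable_poly beta n) 0 * gamma_pdf alpha p y).
  by apply: eq_Rintegral => y _; rewrite /mixed_density mul0r.
rewrite RintegralZl//; last exact: gamma_pdf_integrable.
rewrite g1 mulr1; elim: n => [|n IH].
  by rewrite /pexp oppr0 expR0 hornerC mulr1.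
have n0 : n.+1%:R != 0 :> R by rewrite pnatr_eq0.
apply: (mulfI n0); rewrite pexp_stable_polyS mulr0 mul0r subr0 IH mulr0.
by case: n {IH n0} => [|n]; rewrite ?mul0r// mulr0.
Qed.

End time_derivative.

Section sfpp.
Context (R : realType) (beta alpha p : R) d (T : measurableType d)
  (P : probability T R) (W : R -> {RV P >-> nat}).
Hypotheses (b0 : 0 < beta) (hW : is_sfpp beta alpha p W).

Lemma sfpp_pmfz (t : R) : 0 <= t -> pmfz (W t) = polya_pmfz beta alpha p t.
Proof.
move=> t0; have [D [N [G [hD hN hG hI WE]]]] := hW.
apply/funext => -[n|n]; rewrite /pmfz /=.
  have -> : [set w | (W t w)%:Z = n%:Z] = [set w | W t w = n].
    by apply/seteqP; split => w /= => [[]|->].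
  by rewrite (sfpp_law b0 hD hN hG hI n t0 (WE t t0)).
rewrite (_ : [set w | _] = set0) ?measure0//.
by apply/seteqP; split.
Qed.

(** Read off from the existence of a variable with this density. *)
Lemma sfpp_gamma_mass :
  \int[lebesgue_measure]_(y in `]0%R, +oo[) gamma_pdf alpha p y = 1.
Proof.
have [D [N [G [_ _ [mG hG] _ _]]]] := hW.
have := hG setT measurableT; rewrite preimage_setT probability_setT => e.
rewrite /Rintegral -[RHS]/(fine (1%:E : \bar R)) e [in LHS]integral_mkcond; congr fine.
apply: eq_integral => y _; rewrite patchE; case: ifPn => //.
by rewrite notin_setE/= in_itv/= andbT => /negP/negbTE y0; rewrite /gamma_pdf y0.
Qed.
End sfpp.

Unset Implicit Arguments.
Set Printing Implicit Defensive.

(* W is an SFPP with parameters (alpha, p) and W' one with parameters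
   (alpha, p + k beta), possibly on another probability space. *)
Theorem theorem5p3 (R : realType) (k n : nat) (beta alpha p : R)
    (d : measure_display) (T : measurableType d) (P : probability T R)
    (W : R -> {RV P >-> nat})
    (d' : measure_display) (T' : measurableType d') (P' : probability T' R)
    (W' : R -> {RV P' >-> nat}) :
  (1 <= k)%N -> 0 < beta -> beta <= 1 -> 0 < alpha -> 0 < p ->
  is_sfpp beta alpha p W ->
  is_sfpp beta alpha (p + k%:R * beta) W' ->
  is_nderive_ge0 k (fun t => pmfz (W t) n%:Z)
    (fun t => sfpp_op_pow beta alpha p k (fun m : int => pmfz (W' t) m) n%:Z)
  /\ pmfz (W 0) n%:Z = (n == 0%N)%:R.
Proof.
move=> _ b0 _ a0 p0 hW hW'; split.
  apply: is_nderive_ge0_ext (polya_pmf_nderive b0 a0 k n p0) => t t0.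
    by rewrite (sfpp_pmfz b0 hW t0).
  by rewrite -(sfpp_pmfz b0 hW' t0).
rewrite (sfpp_pmfz b0 hW (lexx 0)); apply: polya_pmf0 => //.
exact: sfpp_gamma_mass hW.
Qed.
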